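(* The subspaces $\mathbf{\Pi}^B$ and $\mathbf{\Pi}^D$ are graded sub-coalgebras of $(\textbf{W},\Delta_\odot,\epsilon_\odot)$ and graded right module coalgebras for $(\mathbf{\Pi},\nabla_{\sqcup\!\sqcup},\iota_{\sqcup\!\sqcup},\Delta_\odot,\epsilon_\odot)$.
   Context: Let $\Bbbk$ be a field of characteristic zero. For a word $w=w_1\cdots w_m$ of positive integers with $\max(w)\le n$, $[w,n]$ is the linear endomorphism of the $\Bbbk$-span of all words sending a word $v$ of length $n$ to $v_{w_1}\cdots v_{w_m}$ and others to $0$; $\textbf{W}$ is their span, a graded bialgebra (degree $m$) with product $\nabla_{\sqcup\!\sqcup}([v,m]\otimes[w,n])=[v\sqcup\!\sqcup(w\uparrow m),m+n]$ ($\sqcup\!\sqcup$ the shuffle product of words, $w\uparrow m$ adds $m$ to each letter), unit $\iota_{\sqcup\!\sqcup}(1)=[\emptyset,0]$, coproduct $\Delta_\odot([w,n])=\sum_i[w_1\cdots w_i,n]\otimes[w_{i+1}\cdots w_m,n]$ and counit $\epsilon_\odot([w,n])=1$ if $w=\emptyset$, else $0$. $\mathbf{\Pi}$ is the sub-bialgebra spanned by $[\pi]=\sum_{w\in\mathcal{R}(\pi)}[w,n]$ for $\pi\in S_{n+1}$ with reduced words $\mathcal{R}(\pi)$ for $s_i=(i,i+1)$. $B_n$ is the group of signed permutations of $\{\pm1,\dots,\pm n\}$, generated by $s^B_1=(-1,1)$ and $s^B_i=(-i,-i+1)(i-1,i)$ for $2\le i\le n$; $D_n$ is generated by $s^D_1=s^B_1s^B_2s^B_1$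 and $s^D_i=s^B_i$ for $i\ge2$. For $\pi\in B_n$, $\mathcal{R}^B(\pi)$ and $\mathcal{R}^D(\pi)$ are the sets of reduced words in these generators, $[\pi]_B=\sum_{w\in\mathcal{R}^B(\pi)}[w,n]$ and $[\pi]_D=\sum_{w\in\mathcal{R}^D(\pi)}[w,n]$; $\mathbf{\Pi}^B=\bigoplus_{n\ge1}\operatorname{span}\{[\pi]_B:\pi\in B_n\}$ and $\mathbf{\Pi}^D=\bigoplus_{n\ge2}\operatorname{span}\{[\pi]_D:\pi\in D_n\}$. For a (graded) bialgebra $B$, a (graded) right $B$-module coalgebra is a (graded) coalgebra $M$ which is a right $B$-module such that the multiplication $M\otimes B\to M$ is a (graded) coalgebra morphism; here the action is via $\nabla_{\sqcup\!\sqcup}$. *)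

(* Defs.v *)
From HB Require Import structures.
From mathcomp Require Import all_boot all_order all_algebra all_fingroup.
From mathcomp Require Import finmap monalg.
Set Implicit Arguments. Unset Strict Implicit. Unset Printing Implicit Defensive.
Import GRing.Theory.
Local Open Scope ring_scope.

(* A basis element [w,n] of W is encoded by the key (w, n) : seq nat * nat. *)
Definition key := (seq nat * nat)%type.

Fixpoint shuffle (u v : seq nat) : seq (seq nat) :=
  match u with
  | [::] => [:: v]
  | a :: u' =>
      let fix sh (v : seq nat) :=
        match v with
        | [::] => [:: u]
        | b :: v' => map (cons a) (shuffle u' v) ++ map (cons b) (sh v')
        end in sh v
  end.

(* product of a word of generators, s_{w1} o ... o s_{wm} (as composition of
   maps; mathcomp's perm product (s * t) applies s first, hence the rev) *)
Definition wprod (gT : finGroupType) (g : nat -> gT) (w : seq nat) : gT :=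
  (\prod_(i <- rev w) g i)%g.

(* words with letters in {1..n} are encoded by sequences of 'I_n (letter = i+1) *)
Definition wd n (t : seq 'I_n) : seq nat := map (fun i => (val i).+1) t.

Definition reducedb (gT : finGroupType) (g : nat -> gT) n (t : seq 'I_n) (x : gT)
  : bool :=
  (wprod g (wd t) == x) &&
  [forall m : 'I_(size t), [forall u : m.-tuple 'I_n, wprod g (wd u) != x]].

Section W.
Variable k : fieldType.

Definition W := {malg k[key]}.
(* W (x) W, with basis [v,m] (x) [w,n] encoded by pairs of keys *)
Definition WW := {malg k[(key * key)%type]}.

(* sum_{w in R(x)} [w,n]; every reduced word of an element of a finite group
   gT has length < #|gT|, so the outer sum ranges over all possible lengths *)
Definition rsum (gT : finGroupType) (g : nat -> gT) n (x : gT) : W :=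
  \sum_(m < #|gT|) \sum_(t : m.-tuple 'I_n | reducedb g t x) << (wd t, n) >>.

Definition tens (x y : W) : WW :=
  \sum_(a <- msupp x) \sum_(b <- msupp y) (x@_a * y@_b) *: << (a, b) >>.

Definition mulW (x y : W) : W :=
  \sum_(a <- msupp x) \sum_(b <- msupp y)
     (x@_a * y@_b) *: \sum_(z <- shuffle a.1 (map (addn a.2) b.1)) << (z, a.2 + b.2) >>.

Definition unitW : W := << ([::], 0%N) >>.

Definition copB (a : key) : WW :=
  \sum_(i < (size a.1).+1) << ((take i a.1, a.2), (drop i a.1, a.2)) >>.
Definition cop (x : W) : WW := \sum_(a <- msupp x) x@_a *: copB a.

Definition eps (x : W) : k := \sum_(a <- msupp x | a.1 == [::]) x@_a.

Definition mulWW (X Y : WW) : WW :=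
  \sum_(p <- msupp X) \sum_(q <- msupp Y)
     (X@_p * Y@_q) *: tens (mulW << p.1 >> << q.1 >>) (mulW << p.2 >> << q.2 >>).

Definition homog (m : nat) (x : W) : Prop :=
  forall a, a \in msupp x -> size a.1 = m.
Definition hpart (m : nat) (x : W) : W :=
  \sum_(a <- msupp x | size a.1 == m) x@_a *: << a >>.

Definition span (V : lmodType k) (P : V -> Prop) (x : V) : Prop :=
  exists s : seq (k * V), (forall i, (i < size s)%N -> P (nth (0, 0) s i).2) /\
                          x = \sum_(p <- s) p.1 *: p.2.

Definition graded_subcoalgebra (S : W -> Prop) : Prop :=
  (forall x, S x -> forall m, S (hpart m x)) /\
  (forall x, S x -> span (fun X : WW => exists u v, [/\ S u, S v & X = tens u v])
                         (cop x)).

Definition graded_right_module_coalgebra (M A : W -> Prop) : Prop :=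
  graded_subcoalgebra M /\
  [/\ forall x a, M x -> A a -> M (mulW x a),
      forall x a b, M x -> A a -> A b -> mulW (mulW x a) b = mulW x (mulW a b)
    & forall x, M x -> mulW x unitW = x] /\
  (* the action M (x) A -> M is a (graded) coalgebra morphism *)
  [/\ forall x a, M x -> A a -> cop (mulW x a) = mulWW (cop x) (cop a),
      forall x a, M x -> A a -> eps (mulW x a) = eps x * eps a
    & forall x a p q, M x -> A a -> homog p x -> homog q a ->
                      homog (p + q) (mulW x a)].
End W.

(* Symmetric group S_{n+1}, s_i = (i, i+1) (on 'I_n.+1, value j <-> j+1)   *)
Definition sA n (i : nat) : 'S_n.+1 :=
  match (insub i.-1 : option 'I_n.+1), (insub i : option 'I_n.+1) with
  | Some a, Some b => tperm a b
  | _, _ => 1%g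
  end.

(* Signed permutations of {+-1..+-n}: (j, false) encodes +(j+1),
   (j, true) encodes -(j+1) *)
Definition sidx n := ('I_n * bool)%type.
Definition sneg n (x : sidx n) : sidx n := (x.1, ~~ x.2).
Definition Bgrp n : {set {perm sidx n}} :=
  [set s : {perm sidx n} | [forall x : sidx n, s (sneg x) == sneg (s x)]].

(* s^B_1 = (-1,1), s^B_i = (-i,-i+1)(i-1,i) for 2 <= i <= n *)
Definition sB n (i : nat) : {perm sidx n} :=
  if (insub i.-1 : option 'I_n) is Some b then
    if i == 1%N then tperm (b, false) (b, true)
    else if (insub i.-2 : option 'I_n) is Some a then
      (tperm (b, true) (a, true) * tperm (a, false) (b, false))%g
    else 1%g
  else 1%g.

Definition sD n (i : nat) : {perm sidx n} :=
  if i == 1%N then (sB n 1 * sB n 2 * sB n 1)%g else sB n i.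
Definition Dgrp n : {set {perm sidx n}} :=
  <<[set sD n (val i).+1 | i : 'I_n]>>%g.

Section Pi.
Variable k : fieldType.
Definition PiA_gen (x : W k) : Prop :=
  exists n (p : 'S_n.+1), x = rsum k (sA n) n p.
Definition PiB_gen (x : W k) : Prop :=
  exists n (p : {perm sidx n}), [/\ (0 < n)%N, p \in Bgrp n & x = rsum k (sB n) n p].
Definition PiD_gen (x : W k) : Prop :=
  exists n (p : {perm sidx n}), [/\ (1 < n)%N, p \in Dgrp n & x = rsum k (sD n) n p].
Definition PiA := span PiA_gen.
Definition PiB := span PiB_gen.
Definition PiD := span PiD_gen.
End Pi.
Arguments PiA : clear implicits.
Arguments PiB : clear implicits.
Arguments PiD : clear implicits.

(* Main.v *)
Require Import Defs.
From HB Require Import structures.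
From mathcomp Require Import all_boot all_order all_algebra all_fingroup.
From mathcomp Require Import finmap monalg.
From mathcomp Require Import zify.

Set Implicit Arguments.
Unset Strict Implicit.
Unset Printing Implicit Defensive.

Import GRing.Theory.

(** The product [[pi]_B . [sigma]] is the sum of the words [u] whose letters
    [<= n] form a reduced word of [pi] and whose letters [> n], shifted down
    by [n], form a reduced word of [sigma].  By Matsumoto's theorem, two reduced
    words of one element are linked by moves exchanging two alternating words
    [sts...] and [tst...].  Such a move preserves the set of these [u]: if
    [s <= n < t], an alternating word of length at least 3 would put two equal
    letters side by side in one of the two subwords, so the move is the
    commutation [st = ts].  The exchange condition then shows that each such
    [u] is reduced, so the product is a sum of classes [[rho]_B]; type D is
    identical.  The exchange condition itself comes from the action on roots,
    encoded as pairs of elements of [{+-1..+-n}].  The coproduct splits a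
    reduced word into two reduced words, and the compatibility axioms hold for
    all of [W]. *)

(** * Words and reduced words *)

Definition letters n (w : seq nat) := all (fun i => 0 < i <= n) w.

Lemma letters_cat n u v : letters n (u ++ v) = letters n u && letters n v.
Proof. exact: all_cat. Qed.

Section Words.
Variables (gT : finGroupType) (g : nat -> gT).

Lemma wprod_nil : wprod g [::] = 1%g.
Proof. by rewrite /wprod /= big_nil. Qed.

Lemma wprod_cat u v : wprod g (u ++ v) = (wprod g v * wprod g u)%g.
Proof. by rewrite /wprod rev_cat big_cat. Qed.

Lemma wprod_seq1 s : wprod g [:: s] = g s.
Proof. by rewrite /wprod big_seq1. Qed.

Lemma wprod_cons s w : wprod g (s :: w) = (wprod g w * g s)%g.
Proof. by rewrite -cat1s wprod_cat wprod_seq1. Qed.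

Lemma wprod_subst a u v b : wprod g u = wprod g v ->
  wprod g (a ++ u ++ b) = wprod g (a ++ v ++ b).
Proof. by move=> e; rewrite !wprod_cat e. Qed.

(** Plain words with a separate alphabet condition take the place of [seq 'I_n], so that words can
    be cut, shifted and moved between alphabets without casts; [reducedbP] is the link with
    [reducedb]. *)
Definition reduced n (w : seq nat) :=
  letters n w /\
  forall v, letters n v -> wprod g v = wprod g w -> size w <= size v.

Lemma reduced_eq n u v : reduced n u -> letters n v ->
  wprod g v = wprod g u -> size v <= size u -> reduced n v.
Proof.
move=> [_ mu] lv e le; split=> // w lw ew.
by apply: leq_trans le _; apply: mu => //; rewrite ew.
Qed.

Lemma reduced_size n u v : reduced n u -> reduced n v ->
  wprod g u = wprod g v -> size u = size v.
Proof.
by move=> [lu mu] [lv mv] e; apply/eqP; rewrite eqn_leq mu ?mv.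
Qed.

Lemma reduced_infix n a u b : reduced n (a ++ u ++ b) -> reduced n u.
Proof.
move=> [l m]; move: (l); rewrite !letters_cat => /and3P[la lu lb].
split=> // v lv e; have := m (a ++ v ++ b).
rewrite !letters_cat la lb lv !size_cat => /(_ isT).
by rewrite (wprod_subst _ _ e) => /(_ erefl); lia.
Qed.

Lemma reduced_catl n u v : reduced n (u ++ v) -> reduced n u.
Proof. exact: (@reduced_infix _ [::] u v). Qed.

Lemma reduced_catr n u v : reduced n (u ++ v) -> reduced n v.
Proof. by rewrite -[v in _ ++ v]cats0; apply: reduced_infix. Qed.

Lemma reduced_subst n a u v b : reduced n (a ++ u ++ b) ->
  letters n v -> wprod g v = wprod g u -> size v <= size u ->
  reduced n (a ++ v ++ b).
Proof.
move=> r lv e le; have [l _] := r; apply: (reduced_eq r).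
- by move: l; rewrite !letters_cat lv => /and3P[-> _ ->].
- exact: wprod_subst.
by rewrite !size_cat leq_add2l leq_add2r.
Qed.

(** If two prefixes had the same product, the letters between them could be cut out; so the
    [(size w).+1] prefixes give distinct group elements. Hence the bounded sum in [rsum] misses no
    reduced word. *)
Lemma reduced_lt_card n w : reduced n w -> size w < #|gT|.
Proof.
move=> [lw mw].
have lwi i : letters n (take i w) && letters n (drop i w).
  by rewrite -letters_cat cat_take_drop.
have inj : injective (fun i : 'I_(size w).+1 => wprod g (take i w)).
  suff ne (i j : 'I_(size w).+1) : i < j ->
      wprod g (take i w) = wprod g (take j w) -> False.
    move=> i j e; apply: val_inj; case: (ltngtP i j) => // lt.
      by case: (ne i j).
    by case: (ne j i).
  move=> lt e; have := mw (take i w ++ drop j w).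
  case/andP: (lwi i) => li _; case/andP: (lwi j) => _ lj.
  rewrite letters_cat li lj wprod_cat e -wprod_cat cat_take_drop.
  move=> /(_ isT erefl); rewrite size_cat size_drop size_takel; last first.
    by have := ltn_ord i; lia.
  by have := ltn_ord j; lia.
by have := leq_card _ inj; rewrite card_ord.
Qed.

Definition involutive_gens n := forall s, 0 < s <= n -> (g s * g s = 1)%g.

Lemma wprod_square n s b : involutive_gens n -> 0 < s <= n ->
  wprod g [:: s, s & b] = wprod g b.
Proof. by move=> ginv ls; rewrite !wprod_cons -mulgA ginv // mulg1. Qed.

Lemma not_reduced_square n a s b : involutive_gens n ->
  ~ reduced n (a ++ [:: s, s & b]).
Proof.
move=> ginv /reduced_catr; rewrite -[_ :: _ :: b]/([:: s; s] ++ b).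
move=> /reduced_catl[/= /andP[ls _]] /(_ [::] isT).
by rewrite (wprod_square _ ginv) // => /(_ erefl).
Qed.

End Words.

(** * Matsumoto's theorem *)

Fixpoint alternate (s t : nat) j : seq nat :=
  if j is j'.+1 then s :: alternate t s j' else [::].

Lemma size_alternate s t j : size (alternate s t j) = j.
Proof. by elim: j s t => //= j IH s t; rewrite IH. Qed.

Lemma all_alternate (p : pred nat) s t j : p s -> p t -> all p (alternate s t j).
Proof. by elim: j s t => //= j IH s t ps pt; rewrite ps IH. Qed.

Lemma alternate_rcons s t j :
  alternate s t j.+1 = rcons (alternate s t j) (if odd j then t else s).
Proof. by elim: j s t => // j IH s t; rewrite /= if_neg -IH. Qed.

Section Matsumoto.
Variables (gT : finGroupType) (g : nat -> gT) (n : nat).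
(** [desc x t] is to be read as: some shortest word of [x] starts with [t]. Keeping it abstract lets
    types B and D share the argument. *)
Variable desc : gT -> nat -> bool.
Hypothesis ginv : involutive_gens g n.
Hypothesis desc_exchange : forall w t, letters n w -> 0 < t <= n ->
  desc (wprod g w) t ->
  exists p x q, w = p ++ x :: q /\ wprod g (t :: p ++ q) = wprod g w.
Hypothesis desc_total : forall x t, 0 < t <= n -> desc x t || desc (x * g t)%g t.

Local Notation reduced := (reduced g n).
Local Notation wprod := (wprod g).

Lemma letters_del p x q : letters n (p ++ x :: q) -> letters n (p ++ q).
Proof. by rewrite !letters_cat /= => /and3P[-> _ ->]. Qed.

(** By totality [t] is a descent of [w] or of [t :: w]. In the second case a word for [t :: w] of
    length at most [size w] would, by exchange, lose a letter and become a word for [w] shorter than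
    [w]. *)
Lemma exchange w t : reduced w -> 0 < t <= n ->
  (exists p x q, w = p ++ x :: q /\ wprod (t :: p ++ q) = wprod w) \/
  reduced (t :: w).
Proof.
move=> rw lt; have [lw mw] := rw.
case/orP: (desc_total (wprod w) lt) => d; first by left; apply: desc_exchange.
right; split=> [|v lv ev]; first by rewrite /letters /= lt.
rewrite /= ltnNge; apply/negP => le.
have [|p [x [q [ep eq]]]] := @desc_exchange v t lv lt.
  by rewrite ev wprod_cons.
have: size w <= size (p ++ q).
  apply: mw; first by apply: (@letters_del p x); rewrite -ep.
  rewrite -[LHS]mulg1 -(ginv lt) mulgA -wprod_cons eq ev wprod_cons.
  by rewrite -mulgA ginv // mulg1.
by move: le; rewrite ep !size_cat /=; lia.
Qed.

Definition braid_closed (P : seq nat -> Prop) := forall a b s t j,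
  0 < s <= n -> 0 < t <= n ->
  wprod (alternate s t j) = wprod (alternate t s j) ->
  P (a ++ alternate s t j ++ b) <-> P (a ++ alternate t s j ++ b).

(** Impredicative form of the equivalence generated by the moves: it transports every closed
    predicate directly, and [separated] is the one it will be applied to. *)
Definition braid_equiv u v := forall P, braid_closed P -> P u <-> P v.

Lemma braid_equiv_sym u v : braid_equiv u v -> braid_equiv v u.
Proof. by move=> e P cP; have := e P cP; tauto. Qed.

Lemma braid_equiv_trans v u w :
  braid_equiv u v -> braid_equiv v w -> braid_equiv u w.
Proof. by move=> e1 e2 P cP; have := e1 P cP; have := e2 P cP; tauto. Qed.

Lemma braid_equiv_cat a b u v :
  braid_equiv u v -> braid_equiv (a ++ u ++ b) (a ++ v ++ b).
Proof.
move=> e P cP; apply: (e (fun w => P (a ++ w ++ b))) => a' b' s t j ls lt ej.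
have := @cP (a ++ a') (b' ++ b) s t j ls lt ej.
by rewrite !catA.
Qed.

Lemma braid_equiv_move s t j : 0 < s <= n -> 0 < t <= n ->
  wprod (alternate s t j) = wprod (alternate t s j) ->
  braid_equiv (alternate s t j) (alternate t s j).
Proof.
by move=> ls lt e P /(_ [::] [::] s t j ls lt e); rewrite !cats0.
Qed.

(* Matsumoto's theorem with arbitrary dihedral moves in place of the braid
   relations, so that no Coxeter matrix is needed. *)
Lemma matsumoto u v : reduced u -> reduced v -> wprod u = wprod v ->
  braid_equiv u v.
Proof.
move: {2}(size u) (erefl (size u)) => k; elim: k u v => [|k IH] u v su ru rv e.
  have sv := reduced_size ru rv e.
  by case: u v su sv {ru rv e} => [|//] [|//] _ _ P _.
have head x u1 v1 : size u1 = k -> reduced (x :: u1) -> reduced (x :: v1) ->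
    wprod (x :: u1) = wprod (x :: v1) -> braid_equiv (x :: u1) (x :: v1).
  move=> s1 r1 r2; rewrite !wprod_cons => /mulIg e1.
  have := @braid_equiv_cat [:: x] [::] u1 v1; rewrite !cats0; apply.
  by apply: IH => //; [move: r1 | move: r2]; rewrite -cat1s; apply: reduced_catr.
have tail x u1 v1 : size u1 = k -> reduced (rcons u1 x) -> reduced (rcons v1 x) ->
    wprod (rcons u1 x) = wprod (rcons v1 x) ->
    braid_equiv (rcons u1 x) (rcons v1 x).
  rewrite -!cats1 !wprod_cat => s1 r1 r2 /mulgI e1.
  apply: (@braid_equiv_cat [::] [:: x]).
  by apply: IH => //; [move: r1 | move: r2]; apply: reduced_catl.
(* Exchange yields [t :: p ++ q] from [u'] by deleting a letter [x]. If [x] is not last, this word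
   shares its last letter with [u'] and its first with [t :: v1], so [tail] and [head] link all
   three. The second alternative is the deletion of the last letter. *)
have step u' t v1 : size u' = k.+1 -> reduced u' -> reduced (t :: v1) ->
    wprod u' = wprod (t :: v1) -> braid_equiv u' (t :: v1) \/
    exists p x, [/\ u' = rcons p x, reduced (t :: p),
      wprod (t :: p) = wprod u' & braid_equiv (t :: p) (t :: v1)].
  move=> su' ru' rv' e'; have [lv' _] := rv'; case/andP: (lv') => lt lv1.
  have nr : ~ reduced (t :: u').
    move=> [_ /(_ v1 lv1)]; rewrite wprod_cons e' wprod_cons.
    rewrite -mulgA ginv // mulg1 => /(_ erefl) /=.
    by have := reduced_size ru' rv' e'; rewrite su' /=; lia.
  have [[p [x [q [eu' epq]]]]|//] := exchange ru' lt.
  have sz : size (p ++ q) = k by move: su'; rewrite eu' !size_cat /=; lia.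
  have rpq : reduced (t :: p ++ q).
    apply: (reduced_eq ru') => //; rewrite /= ?sz ?su' // /letters /= lt.
    by apply: (@letters_del p x); case: ru'; rewrite eu'.
  have h : braid_equiv (t :: p ++ q) (t :: v1) by apply: head; rewrite ?epq.
  case/lastP: q => [|q y] in eu' epq sz rpq h *.
    by right; exists p, x; rewrite eu' cats1 cats0 in epq rpq h *.
  left; apply: braid_equiv_trans h.
  have eL : u' = rcons (p ++ x :: q) y by rewrite eu' rcons_cat.
  have eR : t :: p ++ rcons q y = rcons (t :: p ++ q) y by rewrite rcons_cons rcons_cat.
  rewrite eL eR in ru' epq rpq su' *; apply: tail => //.
  by move: su'; rewrite size_rcons => -[].
(* Each time [step] deletes the last letter, the alternating prefix grows by one, [c] shrinks by
   one, and the two words trade roles. When [c] is empty both words are alternating and a single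
   move joins them. *)
have key c : forall s t j v1, 0 < j ->
    size (alternate s t j ++ c) = k.+1 -> reduced (alternate s t j ++ c) ->
    reduced (t :: v1) -> wprod (alternate s t j ++ c) = wprod (t :: v1) ->
    braid_equiv (alternate s t j ++ c) (t :: v1).
  elim/last_ind: c => [|c z IHc] s t [//|j] v1 _;
    set u' := alternate s t j.+1 ++ _ => su' ru' rv' e'.
    have [//|[p [x [eu' rp ep h]]]] := step _ _ _ su' ru' rv' e'.
    apply: braid_equiv_trans h.
    have ep' : t :: p = alternate t s j.+1.
      have /(congr1 (take j)) := eu'; rewrite /u' cats0 alternate_rcons.
      move: su'; rewrite eu' size_rcons => -[sp].
      have := size_alternate s t j.+1; rewrite -[alternate _ _ _]cats0.
      rewrite -/u' eu' size_rcons => -[sj].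
      by rewrite -!cats1 !take_cat size_alternate sj ltnn subnn !cats0 => <-.
    rewrite ep' in ep *.
    have [/andP[ls _] _] := ru'; have [/andP[lt _] _] := rv'.
    have := @braid_equiv_move s t j.+1 ls lt; rewrite ep /u' cats0; exact.
  have [//|[p [x [eu' rp ep h]]]] := step _ _ _ su' ru' rv' e'.
  apply: braid_equiv_trans h; apply: braid_equiv_sym.
  move: (eu'); rewrite /u' -rcons_cat => /rcons_inj[epp _].
  rewrite rcons_cat -epp; apply: (IHc t s j.+2 (alternate t s j ++ rcons c z)) => //=.
  - by move: su'; rewrite eu' size_rcons -epp.
  - by move: rp; rewrite -epp.
  by rewrite -[RHS]ep -epp.
case: u v su ru rv e => [//|s u] [|t v] su ru rv e.
  by have := reduced_size ru rv e.
exact: (key u s t 1).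
Qed.

End Matsumoto.

(** * Shuffles of reduced words *)

Definition low n u := [seq i <- u | i <= n].
Definition high n u := [seq i - n | i <- u & n < i].

Definition separated (gJ gK : finGroupType) (hJ : nat -> gJ) (hK : nat -> gK)
    n m x y u :=
  [/\ reduced hJ n (low n u), wprod hJ (low n u) = x,
      reduced hK m (high n u) & wprod hK (high n u) = y].

(** The interface between the group theory and the product: the separated words are reduced, and
    they form a union of complete classes of reduced words. *)
Definition shuffle_closed (gT gJ gK : finGroupType) (g : nat -> gT)
    (hJ : nat -> gJ) (hK : nat -> gK) n m :=
  forall x y u, letters (n + m) u -> separated hJ hK n m x y u ->
  reduced g (n + m) u /\ forall v, reduced g (n + m) v ->
    wprod g u = wprod g v -> separated hJ hK n m x y v.

Section ShuffleReduced.
Variables (gT gJ gK : finGroupType) (g : nat -> gT) (hJ : nat -> gJ).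
Variables (hK : nat -> gK) (n m : nat) (desc : gT -> nat -> bool).
Hypothesis ginv : involutive_gens g (n + m).
Hypothesis desc_exchange : forall w t, letters (n + m) w -> 0 < t <= n + m ->
  desc (wprod g w) t ->
  exists p x q, w = p ++ x :: q /\ wprod g (t :: p ++ q) = wprod g w.
Hypothesis desc_total : forall x t, 0 < t <= n + m ->
  desc x t || desc (x * g t)%g t.
Hypothesis hJinv : involutive_gens hJ n.
Hypothesis hKinv : involutive_gens hK m.
(** This and [wprodK] let an equality of products inside one block of generators be read in the
    group of that block. *)
Hypothesis wprodJ : forall u v, letters n u -> letters n v ->
  wprod g u = wprod g v -> wprod hJ u = wprod hJ v.
Hypothesis wprodK : forall u v, letters m u -> letters m v ->
  wprod g (map (addn n) u) = wprod g (map (addn n) v) ->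
  wprod hK u = wprod hK v.
Hypothesis gJK : forall s t, 0 < s <= n -> n < t <= n + m -> g s <> g t.

Local Notation low := (low n).
Local Notation high := (high n).
Local Notation separated := (separated hJ hK n m).

Lemma low_cat u v : low (u ++ v) = low u ++ low v.
Proof. exact: filter_cat. Qed.

Lemma high_cat u v : high (u ++ v) = high u ++ high v.
Proof. by rewrite /high filter_cat map_cat. Qed.

Lemma low_id u : all (fun i => i <= n) u -> low u = u.
Proof. by move/all_filterP. Qed.

Lemma high_nil u : all (fun i => i <= n) u -> high u = [::].
Proof. by elim: u => //= i u IH /andP[le /IH]; rewrite /high /= ltnNge le. Qed.

Lemma low_nil u : all (fun i => n < i) u -> low u = [::].
Proof. by elim: u => //= i u IH /andP[le /IH]; rewrite leqNgt le. Qed.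

Lemma high_id u : all (fun i => n < i) u -> map (addn n) (high u) = u.
Proof.
elim: u => //= i u IH /andP[le /IH]; rewrite /high /= le /= => ->.
by rewrite subnKC // ltnW.
Qed.

Lemma letters_low u : letters (n + m) u -> letters n (low u).
Proof.
move=> /allP lu; apply/allP => i; rewrite mem_filter => /andP[-> /lu].
by case/andP=> ->.
Qed.

Lemma letters_high u : letters (n + m) u -> letters m (high u).
Proof.
move=> /allP lu; apply/allP => i /mapP[j]; rewrite mem_filter.
by case/andP=> lt /lu + ->; lia.
Qed.

(** A move with both letters on the same side of [n] changes only one of the two subwords, and there
    it preserves length and product by [wprodJ] or [wprodK]. *)
Lemma separated_braid x y : braid_closed g (n + m) (separated x y).
Proof.
suff imp a b s t j : 0 < s <= n + m -> 0 < t <= n + m ->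
    wprod g (alternate s t j) = wprod g (alternate t s j) ->
    separated x y (a ++ alternate s t j ++ b) ->
    separated x y (a ++ alternate t s j ++ b).
  by move=> a b s t j ls lt e; split; apply: imp.
move=> ls lt e; rewrite /separated !low_cat !high_cat => -[rl <- rh <-].
have la : letters (n + m) (alternate t s j) by apply: all_alternate.
have la' : letters (n + m) (alternate s t j) by apply: all_alternate.
have [sn|sn] := leqP s n; have [tn|tn] := leqP t n.
- have [p q] : all (fun i => i <= n) (alternate s t j) /\
      all (fun i => i <= n) (alternate t s j) by split; apply: all_alternate.
  move: rl rh; rewrite (low_id p) (low_id q) (high_nil p) (high_nil q) => rl rh.
  have := letters_low la; have := letters_low la'.
  rewrite (low_id p) (low_id q) => l1 l2.
  have e' := wprodJ l1 l2 e.
  split=> //; last exact: wprod_subst.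
  by apply: (reduced_subst rl) => //; rewrite !size_alternate.
(* Letters on different sides: length 1 contradicts [gJK], length 2 leaves both subwords unchanged,
   and from length 3 on the low subword contains [s] twice in a row. The next case is the same with
   the high subword. *)
- case: j e la la' rl rh => [//|[|[|j]]] /= e la la'.
  + by case: (@gJK s t); rewrite -?wprod_seq1 ?e //; lia.
  + by rewrite /low /high /= sn tn /= (leqNgt t) tn (ltnNge n s) sn.
  rewrite /low /= sn (leqNgt t) tn /= => rl.
  by case: (not_reduced_square hJinv rl).
- case: j e la la' rl rh => [//|[|[|j]]] /= e la la'.
  + by case: (@gJK t s); rewrite -?wprod_seq1 ?e //; lia.
  + by rewrite /low /high /= sn tn /= (leqNgt s) sn (ltnNge n t) tn.
  rewrite /high /= sn (ltnNge n t) tn /= => _ rh.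
  by case: (not_reduced_square hKinv rh).
have [p q] : all (fun i => n < i) (alternate s t j) /\
    all (fun i => n < i) (alternate t s j) by split; apply: all_alternate.
move: rl rh; rewrite (low_nil p) (low_nil q) => rl rh.
have e' := wprodK (letters_high la') (letters_high la).
rewrite (high_id p) (high_id q) in e'; have {}e' := e' e.
split=> //; last exact: wprod_subst.
apply: (reduced_subst rh) => //; first exact: letters_high.
rewrite -(size_map (addn n)) -(size_map (addn n) (high (alternate s t j))).
by rewrite (high_id p) (high_id q) !size_alternate.
Qed.

Lemma separated_wprod x y u v : reduced g (n + m) u -> reduced g (n + m) v ->
  wprod g u = wprod g v -> separated x y u -> separated x y v.
Proof.
move=> ru rv e.
by have [] := matsumoto ginv desc_exchange desc_total ru rv e (@separated_braid x y).
Qed.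

(** Induction on the word. If [s :: u] were not reduced, exchange would give another reduced word
    [s :: p ++ q] of the element of [u], with subwords for the same two elements as [u]. In the
    block of [s], prepending [s] once more would then give a reduced word starting with [s]
    twice. *)
Lemma separated_reduced x y u : letters (n + m) u -> separated x y u ->
  reduced g (n + m) u.
Proof.
move=> lu [rl _ rh _] {x y}; elim: u lu rl rh => [|s u IH] //.
move=> /andP[ls lu] rl rh.
have rl' : reduced hJ n (low u).
  by move: rl; rewrite -cat1s low_cat; apply: reduced_catr.
have rh' : reduced hK m (high u).
  by move: rh; rewrite -cat1s high_cat; apply: reduced_catr.
have ru := IH lu rl' rh'.
have [[p [x [q [eu e]]]]|//] := exchange ginv desc_exchange desc_total ru ls.
have rpq : reduced g (n + m) (s :: p ++ q).
  apply: (reduced_eq ru) => //; last by rewrite eu /= !size_cat /= addnS.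
  by rewrite /letters /= ls; apply: (@letters_del _ p x); rewrite -eu.
have su : separated (wprod hJ (low u)) (wprod hK (high u)) u by [].
have [rl2 el2 rh2 eh2] := separated_wprod ru rpq (esym e) su.
have sl := reduced_size rl' rl2 (esym el2).
have sh := reduced_size rh' rh2 (esym eh2).
have [sn|sn] := leqP s n.
  case: (@not_reduced_square _ hJ n [::] s (low (p ++ q)) hJinv).
  move: rl rl2 el2 sl; rewrite /low /= sn => rl [lr2 _] el2 sl.
  apply: (reduced_eq rl) => /=; last by rewrite sl.
    by move: (ls) lr2; rewrite /letters /= sn => /andP[-> _].
  by rewrite !(wprod_cons _ s) -el2 wprod_cons.
case: (@not_reduced_square _ hK m [::] (s - n) (high (p ++ q)) hKinv).
move: rh rh2 eh2 sh; rewrite /high /= sn /= => rh [lr2 _] eh2 sh.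
apply: (reduced_eq rh) => /=; last by rewrite sh.
  by move: lr2; rewrite /letters /= => /andP[-> ->].
by rewrite !(wprod_cons _ (s - n)) -eh2 wprod_cons.
Qed.

Lemma separated_closed : shuffle_closed g hJ hK n m.
Proof.
move=> x y u lu su; have ru := separated_reduced lu su.
by split=> // v rv e; apply: separated_wprod su.
Qed.

End ShuffleReduced.

(** * Roots and reflections of signed permutations *)

Section Roots.
Variable N : nat.
Implicit Types (x y a b : sidx N) (s : {perm sidx N}).

Lemma snegK : involutive (@sneg N).
Proof. by case=> i c; rewrite /sneg /= negbK. Qed.

Lemma sneg_neq x : sneg x != x.
Proof. by apply/eqP => /(congr1 snd) /=; case: x.2. Qed.

Lemma sneg_eq x y : (sneg x == y) = (x == sneg y).
Proof. exact: (can2_eq snegK snegK). Qed.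

Lemma BgrpP s : reflect (forall x, s (sneg x) = sneg (s x)) (s \in Bgrp N).
Proof. by rewrite inE; apply: (iffP forallP) => H x; apply/eqP/H. Qed.

Lemma Bgrp1 : 1%g \in Bgrp N.
Proof. by apply/BgrpP => x; rewrite !perm1. Qed.

Lemma BgrpM s t : s \in Bgrp N -> t \in Bgrp N -> (s * t)%g \in Bgrp N.
Proof. by move=> /BgrpP hs /BgrpP ht; apply/BgrpP => x; rewrite !permM hs ht. Qed.

Lemma BgrpV s : s \in Bgrp N -> (s^-1)%g \in Bgrp N.
Proof.
by move=> /BgrpP hs; apply/BgrpP => x; apply: (@perm_inj _ s); rewrite hs !permKV.
Qed.

(* The reflection in the root [b - a], where [x : sidx N] stands for a signed
   standard basis vector: it also exchanges [- a] and [- b]. *)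
Definition rfl a b : {perm sidx N} :=
  (tperm a b * if b == sneg a then 1 else tperm (sneg a) (sneg b))%g.

Lemma rflE a b x : a != b -> rfl a b x =
  if x == a then b else if x == b then a else
  if x == sneg a then sneg b else if x == sneg b then sneg a else x.
Proof.
move=> ab; rewrite /rfl permM; case: (eqVneq b (sneg a)) => [e|nab].
  rewrite perm1; case: tpermP => [->|->|]; rewrite ?eqxx //.
    by rewrite eq_sym (negbTE ab).
  move=> /eqP/negbTE na /eqP/negbTE nb.
  by rewrite na nb -e nb e snegK na.
have anb : a != sneg b by rewrite -sneg_eq eq_sym.
case: (tpermP a b x) => [->|->|/eqP xa /eqP xb].
- by rewrite eqxx tpermD // ?sneg_neq // eq_sym.
- by rewrite (eq_sym b a) (negbTE ab) eqxx tpermD ?sneg_neq // eq_sym.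
rewrite (negbTE xa) (negbTE xb).
by case: tpermP => [->|->|/eqP/negbTE-> /eqP/negbTE->];
  rewrite ?eqxx // (can_eq snegK) eq_sym (negbTE ab).
Qed.

Lemma rfl_Bgrp a b : a != b -> rfl a b \in Bgrp N.
Proof.
move=> ab; apply/BgrpP => x; rewrite !rflE // !sneg_eq !snegK.
have [->|xa] := eqVneq x a.
  by rewrite eq_sym (negbTE (sneg_neq a)); case: eqP.
have [->|xb] := eqVneq x b.
  by rewrite (eq_sym b (sneg b)) (negbTE (sneg_neq b)); case: eqP.
by do 2?case: eqP => _; rewrite ?snegK.
Qed.

Lemma rflJ s a b : s \in Bgrp N -> (rfl a b ^ s)%g = rfl (s a) (s b).
Proof.
move=> /BgrpP hs; rewrite /rfl conjMg tpermJ -!hs (inj_eq perm_inj).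
by case: ifP => _; rewrite ?conj1g ?tpermJ.
Qed.

Lemma tperm_neg_commute a b : a != b -> b != sneg a ->
  commute (tperm a b) (tperm (sneg a) (sneg b)).
Proof.
move=> ab nab; have anb : a != sneg b by rewrite -sneg_eq eq_sym.
by apply/commgP/conjg_fixP; rewrite tpermJ !tpermD ?sneg_neq // eq_sym.
Qed.

Lemma rflK a b : a != b -> (rfl a b * rfl a b = 1)%g.
Proof.
move=> ab; rewrite /rfl; case: ifPn => [_|nab]; first by rewrite mulg1 tperm2.
rewrite {1}tperm_neg_commute // -mulgA (mulgA (tperm a b)) tperm2 mul1g.
exact: tperm2.
Qed.

(** The pairs [(a, b)] and [(sneg b, sneg a)] encode the same root, which is why inversions are
    determined only up to this symmetry. *)
Lemma rfl_neg a b : a != b -> rfl (sneg b) (sneg a) = rfl a b.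
Proof.
move=> ab; have [e|nab] := eqVneq b (sneg a); first by rewrite e snegK.
rewrite /rfl !snegK (negbTE nab) eq_sym (negbTE nab) tperm_neg_commute //.
by rewrite tpermC (tpermC b).
Qed.

(** The position, counted from 0, in the order [-N < ... < -1 < 1 < ... < N]. *)
Definition rk x : nat := if x.2 then N - (val x.1).+1 else N + val x.1.

Lemma rk_inj : injective rk.
Proof.
case=> i c [j d]; rewrite /rk /= => e; have := ltn_ord i; have := ltn_ord j.
move=> jN iN; suff [-> ->] : c = d /\ i = j by [].
suff [-> ?] : c = d /\ i = j :> nat by split=> //; apply: val_inj.
by case: c e; case: d => /= e; split=> //; lia.
Qed.

Section Exchange.
(* [D] excludes the roots [2 e_i], which are not roots in type D. *)
Variables (D : bool) (g : nat -> {perm sidx N}) (ra rb : nat -> sidx N).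

Definition pos_root x y := (rk x < rk y) && (D ==> (y != sneg x)).

Hypothesis root_gen : forall i, 0 < i <= N -> pos_root (ra i) (rb i).
Hypothesis g_rfl : forall i, 0 < i <= N -> g i = rfl (ra i) (rb i).
(** The classical fact behind the exchange condition: a simple reflection makes no positive root
    negative but its own. *)
Hypothesis g_inversion : forall i x y, 0 < i <= N -> pos_root x y ->
  rk (g i y) < rk (g i x) ->
  (x = ra i /\ y = rb i) \/ (x = sneg (rb i) /\ y = sneg (ra i)).

(** The root criterion for descents: the inverse of [s] sends the simple root of [i] to a negative
    root. *)
Definition descent s i := rk ((s^-1)%g (rb i)) < rk ((s^-1)%g (ra i)).

Lemma root_neq x y : pos_root x y -> x != y.
Proof. by case/andP=> lt _; apply: contraTneq lt => ->; rewrite ltnn. Qed.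

Lemma gens_involutive : involutive_gens g N.
Proof. by move=> i li; rewrite g_rfl // rflK // root_neq ?root_gen. Qed.

Lemma gen_Bgrp i : 0 < i <= N -> g i \in Bgrp N.
Proof. by move=> li; rewrite g_rfl // rfl_Bgrp // root_neq ?root_gen. Qed.

Lemma wprod_Bgrp w : letters N w -> wprod g w \in Bgrp N.
Proof.
elim: w => [|i w IH]; first by rewrite wprod_nil Bgrp1.
by rewrite wprod_cons => /andP[/gen_Bgrp hi /IH hw]; apply: BgrpM.
Qed.

Lemma gen_ra i : 0 < i <= N -> g i (ra i) = rb i.
Proof. by move=> li; rewrite g_rfl // rflE ?eqxx // root_neq ?root_gen. Qed.

Lemma gen_rb i : 0 < i <= N -> g i (rb i) = ra i.
Proof.
move=> li; rewrite g_rfl // rflE ?eqxx ?root_neq ?root_gen //.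
by rewrite eq_sym (negbTE (root_neq (root_gen li))).
Qed.

Lemma genV i : 0 < i <= N -> ((g i)^-1 = g i)%g.
Proof. by move=> li; apply: (mulgI (g i)); rewrite gens_involutive // mulgV. Qed.

Lemma descent_total s i : 0 < i <= N -> descent s i || descent (s * g i)%g i.
Proof.
move=> li; rewrite /descent invMg !permM genV // gen_ra // gen_rb //.
by rewrite -neq_ltn (inj_eq rk_inj) (inj_eq perm_inj) eq_sym root_neq ?root_gen.
Qed.

(* The positive root becomes negative at some letter [x] of the word, and just
   before that it is the simple root of [x]. *)
Lemma inversion_letter w a b : letters N w -> pos_root a b ->
  rk ((wprod g w)^-1%g b) < rk ((wprod g w)^-1%g a) ->
  exists p (x : nat) q, w = p ++ x :: q /\
   rfl ((wprod g p)^-1%g a) ((wprod g p)^-1%g b) = g x.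
Proof.
elim: w a b => [|i w IH] a b.
  by rewrite wprod_nil invg1 !perm1 => _ /andP[lt _]; lia.
move=> /andP[li lw] rab; rewrite wprod_cons invMg genV // !permM => inv.
have [lt|] := ltnP (rk (g i b)) (rk (g i a)).
  exists [::], i, w; split=> //; rewrite wprod_nil invg1 !perm1.
  by case: (g_inversion li rab lt) => -[-> ->]; rewrite ?rfl_neg -?g_rfl // root_neq ?root_gen.
rewrite leq_eqVlt (inj_eq rk_inj) (inj_eq perm_inj) (negbTE (root_neq rab)) /=.
move=> lt; have [|p [x [q [-> e]]]] := IH (g i a) (g i b) lw _ inv.
  rewrite /pos_root lt; apply/implyP => hD; case/andP: rab => _.
  by rewrite hD; move/BgrpP: (gen_Bgrp li) => <-; rewrite (inj_eq perm_inj).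
by exists (i :: p), x, q; split=> //; rewrite wprod_cons invMg genV // !permM.
Qed.

(** At the letter [x] found by [inversion_letter], [g x] is the conjugate of [g i] by the inverse of
    [wprod g p]; hence [i :: p] and [rcons p x] have the same product. *)
Lemma descent_exchange w i : letters N w -> 0 < i <= N ->
  descent (wprod g w) i ->
  exists p (x : nat) q, w = p ++ x :: q /\ wprod g (i :: p ++ q) = wprod g w.
Proof.
move=> lw li /(inversion_letter lw (root_gen li))[p [x [q [ew e]]]].
exists p, x, q; split=> //; rewrite ew in lw *.
have hp : wprod g p \in Bgrp N.
  by apply: wprod_Bgrp; move: lw; rewrite letters_cat => /andP[].
rewrite wprod_cons !wprod_cat wprod_cons -e -rflJ ?BgrpV // -g_rfl //.
by rewrite conjgE invgK !mulgA mulgKV.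
Qed.

End Exchange.
End Roots.

(** * The generators of types B and D as reflections *)

Lemma sB_rfl N i (a b : 'I_N) : 1 < i -> val a = i.-2 -> val b = i.-1 ->
  sB N i = rfl (a, false) (b, false).
Proof.
move=> i1 ea eb; have ab : a != b by rewrite -val_eqE ea eb; lia.
rewrite /sB -ea -eb !valK; case: eqP => [?|_]; first lia.
rewrite /rfl xpair_eqE andbF [tperm (b, true) _]tpermC; symmetry.
apply: tperm_neg_commute.
  by rewrite xpair_eqE eqxx andbT.
by rewrite xpair_eqE andbF.
Qed.

Lemma sB1_rfl N (a : 'I_N) : val a = 0 -> sB N 1 = rfl (a, true) (a, false).
Proof. by move=> ea; rewrite /sB -[1.-1]ea valK /rfl /sneg /= eqxx mulg1 tpermC. Qed.

(** [sD N 1] is the conjugate of [sB N 2] by the involution [sB N 1], which flips the sign of the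
    first coordinate only. *)
Lemma sD1_rfl N (a b : 'I_N) : val a = 0 -> val b = 1 ->
  sD N 1 = rfl (a, true) (b, false).
Proof.
move=> ea eb; have ab : a != b by rewrite -val_eqE ea eb.
have ne : (a, true) != (a, false) :> sidx N by rewrite xpair_eqE andbF.
have hB : sB N 1 \in Bgrp N by rewrite (sB1_rfl ea) rfl_Bgrp.
have sq : (sB N 1 * sB N 1 = 1)%g by rewrite (sB1_rfl ea) rflK.
have sV : (sB N 1 = (sB N 1)^-1)%g by apply: (mulgI (sB N 1)); rewrite mulgV.
rewrite /sD /= {1}sV -mulgA -conjgE (sB_rfl (i := 2) _ ea eb) // rflJ //.
by rewrite (sB1_rfl ea) !rflE // !xpair_eqE eqxx /= !(eq_sym b) (negbTE ab).
Qed.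

(** Stated on [nat], so that generators acting on index sets of different sizes can be compared by
    arithmetic. *)
Definition adjswap k j := if j == k then k.+1 else if j == k.+1 then k else j.

Section Values.
Variable N : nat.
Implicit Type x : sidx N.

Lemma sB_val i x : 1 < i <= N ->
  val (sB N i x).1 = adjswap i.-2 (val x.1) /\ (sB N i x).2 = x.2.
Proof.
case: i => [|[|i]] // /andP[_ bN] /=; have aN : i < N by lia.
rewrite (@sB_rfl N i.+2 (Ordinal aN) (Ordinal bN)) // rflE; last first.
  by rewrite xpair_eqE -val_eqE /=; lia.
case: x => j c; rewrite /adjswap !xpair_eqE -!val_eqE /=.
by case: c; rewrite /= ?andbT ?andbF /=; do 2?case: ifP.
Qed.

Lemma sB1_val x : 0 < N ->
  val (sB N 1 x).1 = val x.1 /\ (sB N 1 x).2 = x.2 (+) (val x.1 == 0).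
Proof.
move=> N0; rewrite (@sB1_rfl N (Ordinal N0)) // rflE ?xpair_eqE ?andbF //.
case: x => j c; rewrite !xpair_eqE -!val_eqE /=.
by case: c; rewrite /= ?andbT ?andbF /=; do 2?case: eqP.
Qed.

Lemma sD1_val x : 1 < N ->
  val (sD N 1 x).1 = adjswap 0 (val x.1) /\ (sD N 1 x).2 = x.2 (+) (val x.1 < 2).
Proof.
move=> N1; have N0 : 0 < N by lia.
rewrite (@sD1_rfl N (Ordinal N0) (Ordinal N1)) // rflE ?xpair_eqE ?andbF //.
case: x => j c; rewrite /adjswap !xpair_eqE -!val_eqE /=.
by case: c; case: j => -[|[|j]] lj.
Qed.

Lemma sidx_eq (x y : sidx N) : val x.1 = val y.1 -> x.2 = y.2 -> x = y.
Proof. by case: x y => i c [j d] /= /val_inj-> ->. Qed.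

(** With [rbB] this encodes the simple root [e_i - e_(i-1)] for [i >= 2]. For [i = 1] truncation
    gives index 0 with a minus sign, hence the root [2 e_1]. The default [o] is never reached for
    letters in range. *)
Definition raB (o : 'I_N) i : sidx N := (insubd o i.-2, i == 1).
Definition rbB (o : 'I_N) i : sidx N := (insubd o i.-1, false).

Lemma rootB_gen o i : 0 < i <= N -> pos_root false (raB o i) (rbB o i).
Proof.
move=> li; rewrite /pos_root andbT /rk /= !val_insubd.
have [-> ->] : i.-2 < N /\ i.-1 < N by lia.
by case: eqP; lia.
Qed.

Lemma sB_root_rfl o i : 0 < i <= N -> sB N i = rfl (raB o i) (rbB o i).
Proof.
move=> li; have [l1 l2] : i.-2 < N /\ i.-1 < N by lia.
rewrite /raB /rbB; have [i1|i1] := eqVneq i 1.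
  by rewrite i1 in l1 *; apply: sB1_rfl; rewrite val_insubd l1.
by apply: sB_rfl; rewrite ?val_insubd ?l1 ?l2 //; lia.
Qed.

Lemma sB_inversion o i x y : 0 < i <= N -> pos_root false x y ->
  rk (sB N i y) < rk (sB N i x) ->
  (x = raB o i /\ y = rbB o i) \/ (x = sneg (rbB o i) /\ y = sneg (raB o i)).
Proof.
move=> li; have [l1 l2] : i.-2 < N /\ i.-1 < N by lia.
rewrite /pos_root andbT /rk /raB /rbB /sneg.
have hx := ltn_ord x.1; have hy := ltn_ord y.1.
have [i1|i1] := eqVneq i 1.
  have N0 : 0 < N by lia.
  rewrite i1; have [-> ->] := sB1_val x N0; have [-> ->] := sB1_val y N0.
  case: x hx => j c /= hx; case: y hy => k d /= hy.
  move=> h1 h2; left; split; apply: sidx_eq; rewrite /= ?val_insubd ?N0 /=;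
  by move: h1 h2; case: c; case: d => /=; do 2?case: eqP => /=; lia.
have li' : 1 < i <= N by lia.
have [-> ->] := sB_val x li'; have [-> ->] := sB_val y li'.
case: x hx => j c /= hx; case: y hy => k d /= hy; rewrite /adjswap.
case: c; case: d => /= h1 h2; [right|exfalso|exfalso|left].
all: try (split; apply: sidx_eq); rewrite /= ?val_insubd ?l1 ?l2 //.
all: by move: h1 h2; do 4?case: eqP; lia.
Qed.

(** The maximum affects only [i = 1] among the letters, where the index becomes 1 and the simple
    root becomes [e_1 + e_2]. *)
Definition rbD (o : 'I_N) i : sidx N := (insubd o (maxn i.-1 1), false).

Lemma rootD_gen o i : 1 < N -> 0 < i <= N -> pos_root true (raB o i) (rbD o i).
Proof.
move=> N1 li; rewrite /pos_root /rk /sneg /= xpair_eqE -val_eqE /= !val_insubd.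
have [-> ->] : i.-2 < N /\ maxn i.-1 1 < N by lia.
by case: eqP; lia.
Qed.

Lemma sDE i : i != 1 -> sD N i = sB N i.
Proof. by rewrite /sD => /negbTE->. Qed.

Lemma sD_root_rfl o i : 1 < N -> 0 < i <= N -> sD N i = rfl (raB o i) (rbD o i).
Proof.
move=> N1 li; have [l1 l2] : i.-2 < N /\ maxn i.-1 1 < N by lia.
rewrite /raB /rbD; have [i1|i1] := eqVneq i 1.
  by rewrite i1 in l1 l2 *; apply: sD1_rfl; rewrite val_insubd ?l1 ?l2.
by rewrite sDE //; apply: sB_rfl; rewrite ?val_insubd ?l1 ?l2 //; lia.
Qed.

Lemma sD_inversion o i x y : 1 < N -> 0 < i <= N -> pos_root true x y ->
  rk (sD N i y) < rk (sD N i x) ->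
  (x = raB o i /\ y = rbD o i) \/ (x = sneg (rbD o i) /\ y = sneg (raB o i)).
Proof.
move=> N1 li; have [l1 l2] : i.-2 < N /\ maxn i.-1 1 < N by lia.
rewrite /pos_root; have [i1|i1] := eqVneq i 1; last first.
  rewrite sDE // => /andP[rxy _] inv.
  have -> : rbD o i = rbB o i.
    by rewrite /rbD; have -> : maxn i.-1 1 = i.-1 by lia.
  by apply: sB_inversion => //; rewrite /pos_root andbT.
rewrite /rk /raB /rbD /sneg i1.
have hx := ltn_ord x.1; have hy := ltn_ord y.1.
have [-> ->] := sD1_val x N1; have [-> ->] := sD1_val y N1.
case: x hx => j c /= hx; case: y hy => k d /= hy.
rewrite xpair_eqE -val_eqE /adjswap /=.
(* [sD N 1] changes the indices 0 and 1 and fixes all larger ones, so three cases per index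
   suffice. *)
case: j hx => -[|[|j]] lj /= hx; case: k hy => -[|[|k]] lk /= hy.
all: case: c; case: d => //= /andP[h1 h3] h2; try lia.
  by left; split; apply: sidx_eq; rewrite /= ?val_insubd ?N1 ?hx.
by right; split; apply: sidx_eq; rewrite /= ?val_insubd ?N1 ?hy.
Qed.
End Values.

(** * Parabolic embeddings *)

Section Equivariant.
Variables (T T' : finType) (g : nat -> {perm T}) (g' : nat -> {perm T'}).
Variables (f : T -> T') (h : nat -> nat) (n : nat).
Hypothesis fJ : forall i x, 0 < i <= n -> f (g i x) = g' (h i) (f x).

Lemma wprod_equivariant w x : letters n w ->
  f (wprod g w x) = wprod g' (map h w) (f x).
Proof.
elim: w => [|i w IH]; first by rewrite !wprod_nil !perm1.
by move=> /andP[li lw]; rewrite !wprod_cons !permM fJ // IH.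
Qed.

(** Supplies [wprodJ] and [wprodK]: each small group acts on a set embedded in the set on which the
    large group acts. *)
Lemma wprod_equivariant_inj u v : injective f -> letters n u -> letters n v ->
  wprod g' (map h u) = wprod g' (map h v) -> wprod g u = wprod g v.
Proof.
move=> f_inj lu lv e; apply/permP => x; apply: f_inj.
by rewrite !wprod_equivariant // e.
Qed.
End Equivariant.

Lemma sA_tperm m i (a b : 'I_m.+1) : val a = i.-1 -> val b = i ->
  sA m i = tperm a b.
Proof. by move=> ea eb; rewrite /sA -ea -eb !valK. Qed.

Lemma sA_val m i (x : 'I_m.+1) : 0 < i <= m ->
  val (sA m i x) = adjswap i.-1 (val x).
Proof.
case: i => // i /andP[_ lt]; have lt' : i < m.+1 by lia.
rewrite (@sA_tperm m i.+1 (Ordinal lt') (Ordinal (lt : i.+1 < m.+1))) //.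
rewrite permE /= /adjswap -!val_eqE /=.
by do 2?case: ifP.
Qed.

Lemma sA_involutive m : involutive_gens (sA m) m.
Proof.
case=> // i /andP[_ lt]; have lt' : i < m.+1 by lia.
rewrite (@sA_tperm m i.+1 (Ordinal lt') (Ordinal (lt : i.+1 < m.+1))) //.
exact: tperm2.
Qed.

Section Embeddings.
Variables n m : nat.

Definition embJ (x : sidx n) : sidx (n + m) := (lshift m x.1, x.2).

Lemma embJ_inj : injective embJ.
Proof. by case=> i c [j d] [/val_inj -> ->]. Qed.

Hypothesis n_gt0 : 0 < n.

Lemma embK_subproof (j : 'I_m.+1) : n.-1 + j < n + m.
Proof. by have := ltn_ord j; lia. Qed.

(** The points of the symmetric group go to the values [n, ..., n + m]. They start at [n], not
    [n + 1], because generator [n + i] exchanges [n + i - 1] and [n + i]; this needs [n > 0]. *)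
Definition embK (j : 'I_m.+1) : sidx (n + m) :=
  (Ordinal (embK_subproof j), false).

Lemma embK_inj : injective embK.
Proof. by move=> i j [] e; apply: val_inj; move: e => /=; lia. Qed.

Lemma embJ_sB i x : 0 < i <= n -> embJ (sB n i x) = sB (n + m) i (embJ x).
Proof.
move=> li; have [i1|i1] := eqVneq i 1.
  have nm : 0 < n + m by lia.
  rewrite i1; have [e1 e2] := sB1_val x n_gt0; have [e3 e4] := sB1_val (embJ x) nm.
  by apply: sidx_eq => /=; rewrite ?e3 ?e4.
have [l1 l2] : 1 < i <= n /\ 1 < i <= n + m by lia.
have [e1 e2] := sB_val x l1; have [e3 e4] := sB_val (embJ x) l2.
by apply: sidx_eq => /=; rewrite ?e3 ?e4.
Qed.

Lemma embK_sB i x : 0 < i <= m -> embK (sA m i x) = sB (n + m) (n + i) (embK x).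
Proof.
move=> li; have l2 : 1 < n + i <= n + m by lia.
have [e3 e4] := sB_val (embK x) l2.
apply: sidx_eq; rewrite ?e3 ?e4 //= sA_val // /adjswap /=.
by do 4?case: eqP; lia.
Qed.

(** The point of value [t] is moved by generator [t] and keeps its absolute value under generator
    [s]. *)
Lemma sB_low_high s t : 0 < s <= n -> n < t <= n + m ->
  sB (n + m) s <> sB (n + m) t.
Proof.
move=> ls lt; have tN : t.-1 < n + m by lia.
move=> /permP/(_ (Ordinal tN, false))/(congr1 (fun z => val z.1)).
have lt' : 1 < t <= n + m by lia.
have [-> _] := sB_val (Ordinal tN, false) lt'.
have [s1|s1] := eqVneq s 1.
  have nm : 0 < n + m by lia.
  have [e _] := sB1_val (Ordinal tN, false) nm; rewrite s1 e /= /adjswap.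
  by do 2?case: eqP; lia.
have ls' : 1 < s <= n + m by lia.
have [-> _] := sB_val (Ordinal tN, false) ls'; rewrite /adjswap /=.
by do 4?case: eqP; lia.
Qed.

End Embeddings.

(** * Shuffle closure in type B *)

Lemma sB_involutive n : involutive_gens (sB n) n.
Proof.
case: n => [|n]; first by move=> i; lia.
apply: gens_involutive; first exact: (rootB_gen ord0).
exact: sB_root_rfl.
Qed.

Lemma sB_Bgrp n w : letters n w -> wprod (sB n) w \in Bgrp n.
Proof.
case: n => [|n]; first by case: w => [|[]] //; rewrite wprod_nil Bgrp1.
by apply: wprod_Bgrp; [exact: (rootB_gen ord0) | exact: sB_root_rfl].
Qed.

Lemma shuffle_closedB n m : 0 < n ->
  shuffle_closed (sB (n + m)) (sB n) (sA m) n m.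
Proof.
move=> n0; have o : 'I_(n + m) by apply: (@Ordinal _ 0); lia.
apply: (@separated_closed _ _ _ _ _ _ _ _ (descent (raB o) (rbB o))).
- exact: sB_involutive.
- apply: descent_exchange.
  + exact: rootB_gen.
  + exact: sB_root_rfl.
  exact: sB_inversion.
- apply: descent_total.
  + exact: rootB_gen.
  exact: sB_root_rfl.
- exact: sB_involutive.
- exact: sA_involutive.
- move=> u v lu lv e; apply: (wprod_equivariant_inj (@embJ_sB n m n0)) => //.
    exact: embJ_inj.
  by rewrite !map_id.
- move=> u v lu lv e; apply: (wprod_equivariant_inj (embK_sB n0)) e => //.
  exact: embK_inj.
exact: sB_low_high.
Qed.

(** * Shuffle closure in type D *)

Lemma sD_Dgrp n w : letters n w -> wprod (sD n) w \in Dgrp n.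
Proof.
elim: w => [|i w IH]; first by rewrite wprod_nil group1.
rewrite wprod_cons => /andP[li lw]; apply: groupM; first exact: IH.
have lt : i.-1 < n by lia.
apply: mem_gen; apply/imsetP; exists (Ordinal lt) => //=.
by rewrite prednK //; lia.
Qed.

Lemma sD_involutive n : 1 < n -> involutive_gens (sD n) n.
Proof.
move=> n1; have o : 'I_n by apply: (@Ordinal _ 0); lia.
apply: (@gens_involutive _ true _ (raB o) (rbD o)) => i li.
  exact: rootD_gen.
exact: sD_root_rfl.
Qed.

Section EmbeddingsD.
Variables n m : nat.
Hypothesis n_gt1 : 1 < n.

Lemma embJ_sD i x : 0 < i <= n -> embJ m (sD n i x) = sD (n + m) i (embJ m x).
Proof.
move=> li; have [i1|i1] := eqVneq i 1; last by rewrite !sDE // embJ_sB //; lia.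
have nm : 1 < n + m by lia.
rewrite i1; have [e1 e2] := sD1_val x n_gt1.
have [e3 e4] := sD1_val (embJ m x) nm.
by apply: sidx_eq => /=; rewrite ?e3 ?e4.
Qed.

Lemma sD_low_high s t : 0 < s <= n -> n < t <= n + m ->
  sD (n + m) s <> sD (n + m) t.
Proof.
move=> ls lt; have t1 : t != 1 by lia.
rewrite (sDE _ t1); have [s1|s1] := eqVneq s 1; last first.
  by rewrite sDE //; apply: sB_low_high lt; lia.
have tN : t.-1 < n + m by lia.
move=> /permP/(_ (Ordinal tN, false))/(congr1 (fun z => val z.1)).
have lt' : 1 < t <= n + m by lia.
have [-> _] := sB_val (Ordinal tN, false) lt'.
have nm : 1 < n + m by lia.
have [e _] := sD1_val (Ordinal tN, false) nm; rewrite s1 e /= /adjswap.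
by do 4?case: eqP; lia.
Qed.

Lemma shuffle_closedD : shuffle_closed (sD (n + m)) (sD n) (sA m) n m.
Proof.
have o : 'I_(n + m) by apply: (@Ordinal _ 0); lia.
have [n0 N1] : 0 < n /\ 1 < n + m by lia.
have rg i : 0 < i <= n + m -> pos_root true (raB o i) (rbD o i).
  exact: rootD_gen.
have rr i : 0 < i <= n + m -> sD (n + m) i = rfl (raB o i) (rbD o i).
  exact: sD_root_rfl.
apply: (@separated_closed _ _ _ _ _ _ _ _ (descent (raB o) (rbD o))).
- exact: sD_involutive.
- by apply: descent_exchange rg rr _ => i x y li; apply: sD_inversion.
- exact: descent_total rg rr.
- exact: sD_involutive.
- exact: sA_involutive.
- move=> u v lu lv e; apply: (wprod_equivariant_inj embJ_sD) => //.
    exact: embJ_inj.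
  by rewrite !map_id.
(* High letters exceed 1, where the generators of types B and D agree. *)
- have eK i x : 0 < i <= m ->
      embK n0 (sA m i x) = sD (n + m) (n + i) (embK n0 x).
    by move=> li; rewrite embK_sB // sDE //; lia.
  move=> u v lu lv e; apply: (wprod_equivariant_inj eK) e => //.
  exact: embK_inj.
exact: sD_low_high.
Qed.
End EmbeddingsD.

(** * Sums over shuffles and deconcatenations *)

Arguments shuffle : simpl never.

Section Shuffles.
Implicit Types u v w z : seq nat.

Lemma shufflen0 u : shuffle u [::] = [:: u].
Proof. by case: u. Qed.

Lemma shuffle_cons a u b v : shuffle (a :: u) (b :: v) =
  map (cons a) (shuffle u (b :: v)) ++ map (cons b) (shuffle (a :: u) v).
Proof. by []. Qed.

Lemma shuffle_map (f : nat -> nat) u v :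
  shuffle (map f u) (map f v) = map (map f) (shuffle u v).
Proof.
elim: u v => // a u IHu; elim=> // b v IHv.
rewrite shuffle_cons map_cat -!map_comp [LHS]shuffle_cons.
by rewrite -/(map f (b :: v)) -/(map f (a :: u)) IHu IHv -!map_comp.
Qed.

Lemma size_shuffle u v z : z \in shuffle u v -> size z = size u + size v.
Proof.
elim: u v z => [|a u IHu]; first by move=> v z; rewrite inE => /eqP->.
elim=> [|b v IHv] z; first by rewrite inE => /eqP->; rewrite addn0.
rewrite shuffle_cons mem_cat => /orP[] /mapP[y + ->] /=.
  by move/IHu ->.
by move/IHv ->; rewrite addnS.
Qed.

Section Filter.
Variable p : pred nat.

(** When [p] separates the letters of [u] from those of [v], a shuffle remembers both factors.
    Together with [uniq_shuffle], this turns a product of basis elements into a multiplicity-free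
    sum over words described by filters. *)
Lemma mem_shuffle_filter u v z : all p u -> all (predC p) v ->
  (z \in shuffle u v) = (filter p z == u) && (filter (predC p) z == v).
Proof.
move=> pu pv; apply/idP/andP => [|[/eqP<- /eqP<-] {pu pv u v}]; last first.
  elim: z => // a z IH /=.
  case pa: (p a) => /=.
    move: IH; case: [seq x <- z | ~~ p x] => [|b v] IH.
      by move: IH; rewrite shufflen0 !inE => /eqP {1}->.
    by rewrite mem_cat map_f.
  move: IH; case: [seq x <- z | p x] => [|b u] IH.
    by move: IH; rewrite !inE => /eqP {1}->.
  by rewrite mem_cat [X in _ || X]map_f ?orbT.
elim: u v z pu pv => [|a u IHu].
  move=> v z _ pv; rewrite inE => /eqP->; split; last exact/eqP/all_filterP.
  by rewrite -size_eq0 size_filter eqn0Ngt -has_count -all_predC.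
elim=> [|b v IHv] z pu.
  move=> _; rewrite inE => /eqP->; split; first exact/eqP/all_filterP.
  rewrite -size_eq0 size_filter eqn0Ngt -has_count -all_predC.
  by apply: sub_all pu => x /=; rewrite negbK.
move=> pv; rewrite shuffle_cons mem_cat => /orP[] /mapP[y + ->] /=.
  case/andP: (pu) => pa pu'; rewrite pa /= eqseq_cons eqxx.
  by move=> /(IHu _ _ pu' pv).
case/andP: (pv) => /= pb pv'; rewrite (negbTE pb) /= eqseq_cons eqxx.
by move=> /(IHv _ pu pv').
Qed.

Lemma uniq_shuffle u v : all p u -> all (predC p) v -> uniq (shuffle u v).
Proof.
elim: u v => [//|a u IHu]; elim=> [//|b v IHv] pu pv.
case/andP: (pu) => pa pu'; case/andP: (pv) => pb pv'.
rewrite shuffle_cons cat_uniq; apply/and3P; split.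
- by rewrite map_inj_uniq ?IHu // => x y [].
- apply/hasPn => z /mapP[y _ ->]; apply/mapP => -[x _ [ab _]].
  by move: pb; rewrite /= ab pa.
by rewrite map_inj_uniq ?[uniq _]IHv // => x y [].
Qed.

End Filter.

Section Sums.
Variable V : zmodType.
Local Open Scope ring_scope.

Lemma sum_shuffle_cons a u b v (F : seq nat -> V) :
  \sum_(z <- shuffle (a :: u) (b :: v)) F z =
  \sum_(z <- shuffle u (b :: v)) F (a :: z) +
  \sum_(z <- shuffle (a :: u) v) F (b :: z).
Proof. by rewrite shuffle_cons big_cat !big_map. Qed.

(** Induction on the total length, sorting words by first letter. The two sums starting with [c] on
    the left, and the two starting with [a] on the right, recombine into sums over shuffles of full
    words, to which induction applies. *)
Lemma sum_shuffle_assoc u v w (F : seq nat -> V) :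
  \sum_(z <- shuffle u v) \sum_(y <- shuffle z w) F y =
  \sum_(z <- shuffle v w) \sum_(y <- shuffle u z) F y.
Proof.
have [n le] := ubnP (size u + size v + size w)%N.
elim: n => // n IH in u v w F le *.
case: u le => [|a u] le.
  by rewrite big_seq1; apply: eq_bigr => z _; rewrite big_seq1.
case: v le => [|b v] le; first by rewrite shufflen0 !big_seq1.
case: w le => [|c w] le.
  rewrite (shufflen0 (b :: v)) big_seq1; apply: eq_bigr => z _.
  by rewrite shufflen0 big_seq1.
rewrite /= in le.
rewrite (sum_shuffle_cons a u) (sum_shuffle_cons b v c w).
under eq_bigr do rewrite sum_shuffle_cons.
under [X in _ + X = _]eq_bigr do rewrite sum_shuffle_cons.
under [X in _ = X + _]eq_bigr do rewrite sum_shuffle_cons.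
under [X in _ = _ + X]eq_bigr do rewrite sum_shuffle_cons.
rewrite !big_split /= [in LHS]addrACA [in RHS]addrACA.
rewrite -(sum_shuffle_cons a u b v
  (fun z => \sum_(y <- shuffle z w) F (c :: y))).
rewrite -(sum_shuffle_cons b v c w
  (fun z => \sum_(y <- shuffle u z) F (a :: y))).
rewrite !IH /=; try lia.
by rewrite !addrA.
Qed.

Definition sum_deconc (G : seq nat -> seq nat -> V) u : V :=
  \sum_(i < (size u).+1) G (take i u) (drop i u).

Lemma sum_deconc0 G : sum_deconc G [::] = G [::] [::].
Proof. by rewrite /sum_deconc big_ord1. Qed.

Lemma sum_deconc_cons G a u :
  sum_deconc G (a :: u) = G [::] (a :: u) + sum_deconc (fun x => G (a :: x)) u.
Proof. by rewrite /sum_deconc big_ord_recl. Qed.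

Lemma eq_sum_deconc G G' u : G =2 G' -> sum_deconc G u = sum_deconc G' u.
Proof. by move=> e; apply: eq_bigr => i _. Qed.

Lemma sum_deconcD G G' u :
  sum_deconc (fun x y => G x y + G' x y) u = sum_deconc G u + sum_deconc G' u.
Proof. exact: big_split. Qed.

(** The combinatorial content of the multiplicativity of the coproduct: cutting a shuffle amounts to
    cutting both factors and shuffling the left pieces and the right pieces. The empty left piece is
    split off, then induction follows the first letter. *)
Lemma sum_deconc_shuffle u v (G : seq nat -> seq nat -> V) :
  \sum_(z <- shuffle u v) sum_deconc G z =
  sum_deconc (fun p q => sum_deconc (fun p' q' =>
    \sum_(x <- shuffle p p') \sum_(y <- shuffle q q') G x y) v) u.
Proof.
have [n le] := ubnP (size u + size v)%N.
elim: n => // n IH in u v G le *.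
case: u le => [|a u] le.
  rewrite big_seq1 sum_deconc0; apply: eq_sum_deconc => p' q'.
  by rewrite !big_seq1.
case: v le => [|b v] le.
  rewrite shufflen0 big_seq1; apply: eq_sum_deconc => p q.
  by rewrite sum_deconc0 !shufflen0 !big_seq1.
rewrite /= in le.
rewrite sum_shuffle_cons.
under eq_bigr do rewrite sum_deconc_cons.
under [X in _ + X = _]eq_bigr do rewrite sum_deconc_cons.
rewrite !big_split /= addrACA -(sum_shuffle_cons a u b v).
rewrite !IH /=; try lia.
(* [A] and [B] collect the cuts with an empty prefix of [b :: v], respectively of [a :: u]; [Da] and
   [Db] those with both prefixes nonempty, by the first letter of the shuffled prefixes. *)
pose A := sum_deconc (fun p q => \sum_(y <- shuffle q (b :: v)) G (a :: p) y) u.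
pose B := sum_deconc (fun p q => \sum_(y <- shuffle (a :: u) q) G (b :: p) y) v.
pose Da p q := sum_deconc (fun p' q' => \sum_(x <- shuffle p (b :: p'))
  \sum_(y <- shuffle q q') G (a :: x) y) v.
pose Db p q := sum_deconc (fun p' q' => \sum_(x <- shuffle (a :: p) p')
  \sum_(y <- shuffle q q') G (b :: x) y) v.
transitivity (\sum_(z <- shuffle (a :: u) (b :: v)) G [::] z +
    (A + sum_deconc Da u + (B + sum_deconc Db u))).
  congr (_ + (_ + _)).
    rewrite -sum_deconcD; apply: eq_sum_deconc => p q.
    by rewrite sum_deconc_cons shufflen0 big_seq1.
  rewrite sum_deconc_cons; congr (_ + _); apply: eq_sum_deconc => p q.
  by rewrite big_seq1.
rewrite !sum_deconc_cons big_seq1 -[RHS]addrA; congr (_ + _).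
rewrite addrCA; congr (_ + _).
  by apply: eq_sum_deconc => p q; rewrite big_seq1.
rewrite -addrA -!sum_deconcD; apply: eq_sum_deconc => p q.
rewrite sum_deconc_cons shufflen0 big_seq1; congr (_ + _).
by rewrite -sum_deconcD; apply: eq_sum_deconc => p' q'; rewrite sum_shuffle_cons.
Qed.

End Sums.
End Shuffles.

Local Open Scope ring_scope.

(** * The bialgebra of words *)

(* The sums over supports are locked: otherwise failing unifications unfold
   them. *)
HB.lock Definition ext (k : fieldType) (K : choiceType) (V : lmodType k)
    (f : K -> V) (x : {malg k[K]}) : V := \sum_(a <- msupp x) x@_a *: f a.

HB.lock Definition bext (k : fieldType) (K K' : choiceType) (V : lmodType k)
    (f : K -> K' -> V) (x : {malg k[K]}) (y : {malg k[K']}) : V :=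
  ext (fun a => ext (f a) y) x.

Section LinearExtension.
Variables (k : fieldType) (K : choiceType) (V : lmodType k).
Implicit Types (f : K -> V) (x : {malg k[K]}).

Lemma extE f x : ext f x = \sum_(a <- msupp x) x@_a *: f a.
Proof. by rewrite ext.unlock. Qed.

Lemma extEw f (d : {fset K}) x : (msupp x `<=` d)%fset ->
  ext f x = \sum_(a <- d) x@_a *: f a.
Proof.
move=> le; rewrite extE; apply/esym; rewrite (big_fset_incl _ le) // => a _ na.
by rewrite mcoeff_outdom // scale0r.
Qed.

Lemma ext_is_linear f : linear (ext f).
Proof.
move=> c x y; pose d := (msupp x `|` msupp y `|` msupp (c *: x + y))%fset.
have hx : (msupp x `<=` d)%fset by rewrite /d -fsetUA fsubsetUl.
have hy : (msupp y `<=` d)%fset by rewrite /d fsetUAC fsubsetUr.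
have hz : (msupp (c *: x + y) `<=` d)%fset by rewrite fsubsetUr.
rewrite (extEw f hx) (extEw f hy) (extEw f hz) scaler_sumr -big_split.
by apply: eq_bigr => a _; rewrite mcoeffD mcoeffZ scalerDl scalerA.
Qed.

Lemma extP f c x y : ext f (c *: x + y) = c *: ext f x + ext f y.
Proof. exact: ext_is_linear. Qed.

HB.instance Definition _ f :=
  GRing.isLinear.Build k {malg k[K]} V *:%R (ext f) (ext_is_linear f).

Lemma extU f a : ext f << a >> = f a.
Proof.
by rewrite extE msuppU oner_eq0 big_seq_fset1 mcoeffUU scale1r.
Qed.

Lemma malg_linear_ind (P : {malg k[K]} -> Prop) : P 0 ->
  (forall a, P << a >>) -> (forall c x y, P x -> P y -> P (c *: x + y)) ->
  forall x, P x.
Proof.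
move=> P0 PU PD x; rewrite [x]monalgE.
elim: (_ (msupp x)) => [|a s IH]; first by rewrite big_nil.
rewrite big_cons; have -> : << x@_a *g a >> = x@_a *: << a >> :> {malg k[K]}.
  by apply/malgP => b; rewrite mcoeffZ !mcoeffU; case: eqP; rewrite ?mulr1 ?mulr0.
exact: PD.
Qed.

End LinearExtension.

Section BilinearExtension.
Variables (k : fieldType) (K K' : choiceType) (V : lmodType k).
Implicit Types (f : K -> K' -> V) (x : {malg k[K]}) (y : {malg k[K']}).

Lemma bextE f x y : bext f x y =
  \sum_(a <- msupp x) \sum_(b <- msupp y) (x@_a * y@_b) *: f a b.
Proof.
rewrite bext.unlock extE; apply: eq_bigr => a _; rewrite extE scaler_sumr.
by apply: eq_bigr => b _; rewrite scalerA.
Qed.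

Lemma bext_suml f (I : Type) (r : seq I) (X : I -> {malg k[K]}) y :
  bext f (\sum_(i <- r) X i) y = \sum_(i <- r) bext f (X i) y.
Proof. by rewrite bext.unlock; apply: linear_sum. Qed.

End BilinearExtension.

Section BilinearTheory.
Variables (k : fieldType) (K K' : choiceType) (V : lmodType k).
Variable f : K -> K' -> V.
Implicit Types (x : {malg k[K]}) (y : {malg k[K']}).

Lemma bextC x y : bext f x y = bext (fun b a => f a b) y x.
Proof.
rewrite !bextE exchange_big /=; apply: eq_bigr => b _.
by apply: eq_bigr => a _; rewrite mulrC.
Qed.

Lemma bextPl c x x' y : bext f (c *: x + x') y = c *: bext f x y + bext f x' y.
Proof. by rewrite bext.unlock extP. Qed.

Lemma bextPr c x y y' : bext f x (c *: y + y') = c *: bext f x y + bext f x y'.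
Proof. by rewrite !bextC bext.unlock extP. Qed.

Lemma bext0l y : bext f 0 y = 0.
Proof. by rewrite bext.unlock linear0. Qed.

Lemma bext0r x : bext f x 0 = 0.
Proof. by rewrite bextC bext.unlock linear0. Qed.

Lemma bext_sumr (I : Type) (r : seq I) x (Y : I -> {malg k[K']}) :
  bext f x (\sum_(i <- r) Y i) = \sum_(i <- r) bext f x (Y i).
Proof.
by rewrite bextC bext_suml; apply: eq_bigr => i _; rewrite [RHS]bextC.
Qed.

Lemma bextUU a b : bext f << a >> << b >> = f a b.
Proof. by rewrite bext.unlock !extU. Qed.
End BilinearTheory.

Section Bialgebra.
Variable k : fieldType.
Implicit Types (a b : key).

Definition mulB a b : W k :=
  \sum_(z <- shuffle a.1 (map (addn a.2) b.1)) << (z, (a.2 + b.2)%N) >>.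

Lemma mulWE (x y : W k) : mulW x y = bext mulB x y.
Proof. by rewrite bextE. Qed.

Lemma tensE (x y : W k) : tens x y = bext (fun a b => << (a, b) >>) x y.
Proof. by rewrite bextE. Qed.

Lemma copE (x : W k) : cop x = ext (@copB k) x.
Proof. by rewrite extE. Qed.

Lemma mulWWE (X Y : WW k) : mulWW X Y = bext (fun p q =>
  tens (mulW << p.1 >> << q.1 >>) (mulW << p.2 >> << q.2 >>)) X Y.
Proof. by rewrite bextE. Qed.

Lemma epsE (x : W k) : eps x = ext (fun a => (a.1 == [::])%:R : k^o) x.
Proof.
rewrite /eps big_mkcond extE; apply: eq_bigr => a _.
by case: eqP => _; rewrite ?[_ *: _]mulr1 ?[_ *: _]mulr0.
Qed.

Lemma hpartE m (x : W k) :
  hpart m x = ext (fun a => if size a.1 == m then << a >> else 0) x.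
Proof.
rewrite /hpart big_mkcond extE; apply: eq_bigr => a _.
by case: eqP => _; rewrite ?scaler0.
Qed.

Lemma mulWUU a b : mulW << a >> << b >> = mulB a b.
Proof. by rewrite mulWE bextUU. Qed.

Lemma mulWA (x y z : W k) : mulW (mulW x y) z = mulW x (mulW y z).
Proof.
rewrite !mulWE.
elim/malg_linear_ind: x => [|a|c x x' IH IH']; first by rewrite !bext0l.
  elim/malg_linear_ind: y => [|b|c y y' IH IH'].
  - by rewrite bext0r bext0l bext0r.
  - elim/malg_linear_ind: z => [|d|c z z' IH IH']; first by rewrite !bext0r.
      rewrite !bextUU bext_suml bext_sumr.
      under eq_bigr do rewrite bextUU.
      under [RHS]eq_bigr do rewrite bextUU.
      rewrite /mulB /= (sum_shuffle_assoc _ _ _ (fun y => << (y, _) >>)).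
      (* The shift by [a.2] commutes with the inner shuffle and then composes with the shift by
         [b.2]. *)
      rewrite -[in RHS](big_map (map (addn a.2)) xpredT (fun z =>
        \sum_(y <- shuffle a.1 z) << (y, (a.2 + (b.2 + d.2))%N) >>)).
      rewrite -shuffle_map -map_comp addnA.
      by rewrite (eq_map (f := addn a.2 \o addn b.2) (addnA _ _)).
    by rewrite !bextPr IH IH'.
  by rewrite bextPr !bextPl bextPr IH IH'.
by rewrite !bextPl IH IH'.
Qed.

Lemma mulW1 (x : W k) : mulW x (unitW k) = x.
Proof.
rewrite mulWE; elim/malg_linear_ind: x => [|a|c x x' IH IH'].
- by rewrite bext0l.
- by rewrite bextUU /mulB shufflen0 big_seq1 addn0; case: a.
by rewrite bextPl IH IH'.
Qed.

Lemma copB_deconc a : copB k a =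
  sum_deconc (fun p q => << ((p, a.2), (q, a.2)) >>) a.1.
Proof. by []. Qed.

Lemma cop_mulW (x y : W k) : cop (mulW x y) = mulWW (cop x) (cop y).
Proof.
rewrite mulWE !copE mulWWE.
elim/malg_linear_ind: x => [|a|c x x' IH IH'].
- by rewrite bext0l !linear0 bext0l.
- elim/malg_linear_ind: y => [|b|c y y' IH IH'].
  + by rewrite bext0r !linear0 bext0r.
  + rewrite bextUU linear_sum /=.
    under eq_bigr do rewrite extU copB_deconc /=.
    rewrite sum_deconc_shuffle !extU {2}/copB bext_suml.
    apply: eq_bigr => i _; rewrite bext_sumr /sum_deconc size_map.
    apply: eq_bigr => j _; rewrite bextUU /= !mulWUU tensE bext_suml /=.
    rewrite -map_take -map_drop; apply: eq_bigr => z _; rewrite bext_sumr.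
    by apply: eq_bigr => z' _; rewrite bextUU.
  by rewrite bextPr !extP bextPr IH IH'.
by rewrite bextPl !extP bextPl IH IH'.
Qed.

Lemma eps_mulW (x y : W k) : eps (mulW x y) = eps x * eps y.
Proof.
rewrite mulWE !epsE.
elim/malg_linear_ind: x => [|a|c x x' IH IH'].
- by rewrite bext0l !linear0 mul0r.
- elim/malg_linear_ind: y => [|b|c y y' IH IH'].
  + by rewrite bext0r !linear0 mulr0.
  + rewrite bextUU linear_sum /= !extU.
    under eq_bigr do rewrite extU /=.
    case: a.1 => [|i u] /=; first by rewrite big_seq1 mul1r; case: b.1.
    rewrite mul0r big_seq big1 // => z /size_shuffle.
    by rewrite -size_eq0 => ->.
  by rewrite bextPr !extP IH IH' mulrDr; congr (_ + _); apply: mulrCA.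
by rewrite bextPl !extP IH IH' mulrDl; congr (_ + _); apply: mulrA.
Qed.

Lemma mem_msupp_sum (K : choiceType) (I : eqType) (r : seq I) (P : pred I)
    (F : I -> {malg k[K]}) (a : K) :
  a \in msupp (\sum_(i <- r | P i) F i) ->
  exists i, [/\ i \in r, P i & a \in msupp (F i)].
Proof.
elim: r => [|i r IH]; first by rewrite big_nil msupp0.
rewrite big_cons; case: ifP => Pi; last first.
  by case/IH => j [jr Pj aj]; exists j; rewrite inE jr orbT.
move/(fsubsetP (msuppD_le _ _)); rewrite inE => /orP[ai|/IH[j [jr Pj aj]]].
  by exists i; rewrite mem_head.
by exists j; rewrite inE jr orbT.
Qed.

Lemma homog_mulW p q (x y : W k) : homog p x -> homog q y -> homog (p + q) (mulW x y).
Proof.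
move=> hx hy c /mem_msupp_sum[a [/hx ha _]] /mem_msupp_sum[b [/hy hb _]].
move=> /(fsubsetP (msuppZ_le _ _)) /mem_msupp_sum[z [/size_shuffle sz _]].
rewrite msuppU oner_eq0 inE => /eqP->.
by rewrite /= sz size_map ha hb.
Qed.

End Bialgebra.

(** * Spans of reduced word classes *)

Local Notation span := Defs.span.

Section Span.
Variables (k : fieldType) (V : lmodType k) (P : V -> Prop).

Lemma span_ind (Q : V -> Prop) : Q 0 ->
  (forall c x y, P x -> Q y -> Q (c *: x + y)) -> forall x, span P x -> Q x.
Proof.
move=> Q0 QD x [s [Ps ->]] {x}; elim: s Ps => [|p s IH] Ps.
  by rewrite big_nil.
rewrite big_cons; apply: QD; first exact: (Ps 0%N).
by apply: IH => i lt; apply: (Ps i.+1).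
Qed.

Lemma span0 : span P 0.
Proof. by exists [::]; rewrite big_nil. Qed.

Lemma span_cons c x y : P x -> span P y -> span P (c *: x + y).
Proof.
move=> Px [s [Ps ->]]; exists ((c, x) :: s); rewrite big_cons; split=> //.
by case=> // i; apply: Ps.
Qed.

Lemma span_gen x : P x -> span P x.
Proof.
by move=> Px; rewrite -[x]addr0 -[x]scale1r; apply: span_cons Px span0.
Qed.

Lemma spanP c x y : span P x -> span P y -> span P (c *: x + y).
Proof.
move=> sx sy; elim/span_ind: x / sx => [|d x x' Px IH].
  by rewrite scaler0 add0r.
by rewrite scalerDr scalerA -addrA; apply: span_cons.
Qed.

Lemma span_sum (I : eqType) (r : seq I) (F : I -> V) :
  (forall i, i \in r -> span P (F i)) -> span P (\sum_(i <- r) F i).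
Proof.
elim: r => [|i r IH] sF; first by rewrite big_nil; apply: span0.
rewrite big_cons -[F i]scale1r; apply: spanP; first by apply: sF; rewrite mem_head.
by apply: IH => j jr; apply: sF; rewrite inE jr orbT.
Qed.

End Span.

Lemma uniq_flatten_map (S T : eqType) (s : seq S) (F : S -> seq T) (h : T -> S) :
  uniq s -> (forall x, x \in s -> uniq (F x)) ->
  (forall x z, x \in s -> z \in F x -> h z = x) -> uniq (flatten (map F s)).
Proof.
elim: s => //= x s IH /andP[xs us] uF hF; rewrite cat_uniq uF ?mem_head //=.
rewrite IH ?andbT // => [|y ys|y z ys]; last 2 first.
- by apply: uF; rewrite inE ys orbT.
- by apply: hF; rewrite inE ys orbT.
apply/hasPn => z /flatten_mapP[y ys zy]; apply: contra xs => zx.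
by rewrite -(hF x z) ?mem_head // (hF y z) // inE ys orbT.
Qed.

(** The last hypothesis says that [L] is a union of complete classes [R i]. Both the coproduct and
    the product of classes are regrouped by it. *)
Lemma sum_fibers (V : zmodType) (I T : eqType) (L : seq T) (c : T -> I)
    (R : I -> seq T) (F : T -> V) :
  uniq L -> (forall i, uniq (R i)) ->
  (forall t0, t0 \in L -> forall t, (t \in R (c t0)) = (t \in L) && (c t == c t0)) ->
  \sum_(t <- L) F t = \sum_(i <- undup (map c L)) \sum_(t <- R i) F t.
Proof.
move=> uL uR memR.
transitivity (\sum_(i <- undup (map c L)) \sum_(t <- L | c t == i) F t).
  rewrite (exchange_big_dep predT) //= big_seq [RHS]big_seq.
  apply: eq_bigr => t tL.
  rewrite big_mkcond (bigD1_seq (c t)) ?undup_uniq ?mem_undup ?map_f //= eqxx.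
  by rewrite big1 ?addr0 // => i; rewrite eq_sym => /negbTE->.
rewrite big_seq [RHS]big_seq; apply: eq_bigr => i.
rewrite mem_undup => /mapP[t0 t0L ->]; rewrite -big_filter; apply: perm_big.
apply: uniq_perm => [||t]; rewrite ?filter_uniq //.
by rewrite mem_filter andbC memR.
Qed.

(** * The list of reduced words of an element *)

Section ReducedWords.
Variables (gT : finGroupType) (g : nat -> gT) (n : nat).
Implicit Type x : gT.

Lemma letters_wd (t : seq 'I_n) : letters n (wd t).
Proof. by apply/allP => i /mapP[j _ ->] /=. Qed.

Lemma wdP w : letters n w -> exists t : seq 'I_n, w = wd t.
Proof.
elim: w => [|i w IH]; first by exists [::].
move=> /andP[li /IH[t ->]]; have lt : (i.-1 < n)%N by lia.
by exists (Ordinal lt :: t); rewrite /wd /= prednK //; lia.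
Qed.

Lemma wd_inj : injective (@wd n).
Proof. by apply: inj_map => i j [] /val_inj. Qed.

Lemma reducedbP (t : seq 'I_n) x :
  reflect (reduced g n (wd t) /\ wprod g (wd t) = x) (reducedb g t x).
Proof.
apply: (iffP andP) => [[/eqP e /forallP h]|[[_ h] e]].
  split=> //; split=> [|v lv ev]; first exact: letters_wd.
  have [u eu] := wdP lv; rewrite leqNgt; apply/negP => lt.
  have lt' : (size u < size t)%N by move: lt; rewrite eu !size_map.
  have /forallP/(_ (in_tuple u))/eqP[] := h (Ordinal lt').
  by rewrite -e -ev eu.
rewrite e; split=> //; apply/forallP => m; apply/forallP => u; apply/eqP => eu.
have := h (wd u) (letters_wd u); rewrite eu e => /(_ erefl).
by rewrite !size_map size_tuple leqNgt ltn_ord.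
Qed.

Definition rwords x : seq (seq nat) :=
  [seq wd (tval (tagged t)) | t : {m : 'I_#|gT| & m.-tuple 'I_n}
    <- enum [pred t : {m : 'I_#|gT| & m.-tuple 'I_n} | reducedb g (tagged t) x]].

Lemma mem_rwords x w : w \in rwords x <-> reduced g n w /\ wprod g w = x.
Proof.
split=> [/mapP[t + ->]|[rw e]].
  by rewrite mem_enum inE => /reducedbP.
have [lw _] := rw; have [t et] := wdP lw.
have lt : (size t < #|gT|)%N.
  by have := reduced_lt_card rw; rewrite et size_map.
apply/mapP; exists (Tagged (fun m : 'I_#|gT| => m.-tuple 'I_n)
  (in_tuple t : (Ordinal lt).-tuple 'I_n)) => //.
by rewrite mem_enum inE /=; apply/reducedbP; rewrite -et.
Qed.

Lemma uniq_rwords x : uniq (rwords x).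
Proof.
rewrite map_inj_uniq ?enum_uniq // => -[m t] [m' t'] /wd_inj /= e.
have em : m = m' by apply: ord_inj; rewrite -(size_tuple t) e size_tuple.
by case: m' / em t' e => t' /val_inj->.
Qed.

Lemma rsumE (k : fieldType) x :
  rsum k g n x = \sum_(w <- rwords x) << (w, n) >>.
Proof.
rewrite /rsum sig_big_dep big_map big_enum_cond /=.
by apply: eq_bigl => t; rewrite inE andbT.
Qed.

End ReducedWords.

Section GradedParts.
Variables (k : fieldType) (gT : finGroupType) (g : nat -> gT) (n : nat).

(** Reduced words of one element have equal length, so a class lies in a single degree. *)
Lemma hpart_rsum m x : hpart m (rsum k g n x) = rsum k g n x \/
  hpart m (rsum k g n x) = 0.
Proof.
rewrite hpartE rsumE linear_sum /=.
under eq_bigr do rewrite extU.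
case: (rwords g n x) (fun w => iffLR (mem_rwords g n x w)) => [|w0 s] mems.
  by right; rewrite big_nil.
have eqs w : w \in w0 :: s -> size w = size w0.
  move=> /mems[rw ew]; have /mems[rw0 ew0] := mem_head w0 s.
  by apply: reduced_size rw rw0 _; rewrite ew.
have [e|ne] := eqVneq (size w0) m; [left|right]; rewrite big_seq.
  by rewrite [RHS]big_seq; apply: eq_bigr => w /eqs /= ->; rewrite e eqxx.
by apply: big1 => w /eqs /= ->; rewrite (negbTE ne).
Qed.

(** If a reduced word of [x] is cut into [u0] and [v0], replacing them by any reduced words of the
    same two elements gives a reduced word of [x] again. So the cuts form a union of full products
    of classes. The factors come with words to show that they lie in the group at hand. *)
Lemma cop_rsum x : exists s : seq (gT * gT),
  cop (rsum k g n x) =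
    \sum_(p <- s) tens (rsum k g n p.1) (rsum k g n p.2) /\
  forall p, p \in s -> exists u v, [/\ letters n u, letters n v,
    p.1 = wprod g u & p.2 = wprod g v].
Proof.
pose cuts (w : seq nat) := [seq (take i w, drop i w) | i <- index_iota 0 (size w).+1].
pose L := flatten (map cuts (rwords g n x)).
pose c (t : seq nat * seq nat) := (wprod g t.1, wprod g t.2).
pose R (p : gT * gT) := [seq (u, v) | u <- rwords g n p.1, v <- rwords g n p.2].
have memL (u v : seq nat) : ((u, v) \in L) <-> reduced g n (u ++ v) /\ wprod g (u ++ v) = x.
  rewrite -mem_rwords; split=> [/flatten_mapP[w wR /mapP[i _ [-> ->]]]|uvR].
    by rewrite cat_take_drop.
  apply/flatten_mapP; exists (u ++ v) => //; apply/mapP; exists (size u).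
    by rewrite mem_index_iota ltnS size_cat leq_addr.
  by rewrite take_size_cat // drop_size_cat.
exists (undup (map c L)); split; last first.
  move=> p; rewrite mem_undup => /mapP[[u v] /memL[[+ _] _] ->].
  by rewrite letters_cat => /andP[lu lv]; exists u, v.
have -> : cop (rsum k g n x) = \sum_(t <- L) << ((t.1, n), (t.2, n)) >>.
  rewrite copE rsumE linear_sum big_flatten big_map; apply: eq_bigr => w _ /=.
  by rewrite extU big_map big_mkord.
rewrite (sum_fibers (c := c) (R := R)).
- apply: eq_bigr => p _; rewrite tensE !rsumE big_allpairs bext_suml /=.
  apply: eq_bigr => u _; rewrite bext_sumr; apply: eq_bigr => v _.
  by rewrite bextUU.
- apply: (uniq_flatten_map (h := fun t => t.1 ++ t.2)) (uniq_rwords g n x) _ _.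
    move=> w _; rewrite map_inj_in_uniq ?iota_uniq // => i j.
    rewrite !mem_index_iota => li lj [e _]; have := congr1 size e.
    by rewrite !size_takel //; lia.
  by move=> w t _ /mapP[i _ ->]; rewrite cat_take_drop.
- by move=> p; apply: allpairs_uniq; rewrite ?uniq_rwords // => -[? ?] [? ?] _ _ [-> ->].
move=> [u0 v0] /memL[r0 e0] [u v]; apply/allpairsP/andP => /=.
  case=> -[u' v'] /= [/mem_rwords[ru eu] /mem_rwords[rv ev] [-> ->]] {u v}.
  rewrite /c /= eu ev eqxx; split=> //; apply/memL.
  have e : wprod g (u' ++ v') = wprod g (u0 ++ v0).
    by rewrite !wprod_cat eu ev.
  split; last by rewrite e.
  have [lu _] := ru; have [lv _] := rv; apply: (reduced_eq r0) => //.
    by rewrite letters_cat lu.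
  by rewrite !size_cat (reduced_size ru (reduced_catl r0) eu)
     (reduced_size rv (reduced_catr r0) ev).
case=> /memL[r e] /eqP[eu ev]; exists (u, v); split=> //=; apply/mem_rwords.
  by split=> //; apply: reduced_catl r.
by split=> //; apply: reduced_catr r.
Qed.

End GradedParts.

(** The list [L] of all shuffles consists of the separated words, each occurring once; grouping them
    by product gives the classes. *)
Lemma mulW_rsum (k : fieldType) (gT gJ gK : finGroupType) (g : nat -> gT)
    (hJ : nat -> gJ) (hK : nat -> gK) n m x y :
  shuffle_closed g hJ hK n m -> exists s : seq gT,
  mulW (rsum k hJ n x) (rsum k hK m y) =
    \sum_(r <- s) rsum k g (n + m) r /\
  forall r, r \in s -> exists2 u, letters (n + m) u & r = wprod g u.
Proof.
move=> closed.
pose sh w v := shuffle w (map (addn n) v).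
pose L := flatten [seq flatten [seq sh w v | v <- rwords hK m y] | w <- rwords hJ n x].
have split_high v : letters m v -> all (predC (fun i => i <= n)%N) (map (addn n) v).
  by move=> /allP lv; apply/allP => i /mapP[j /lv + ->] /=; lia.
have split_low w : letters n w -> all (fun i => i <= n)%N w.
  by apply: sub_all => i /andP[].
have mem_sh w v z : letters n w -> letters m v ->
    (z \in sh w v) <-> [/\ letters (n + m) z, low n z = w & high n z = v].
  move=> lw lv.
  rewrite (mem_shuffle_filter (p := fun i => i <= n)%N) ?split_low ?split_high //.
  have ehi : [seq i <- z | predC (fun i => i <= n)%N i] = [seq i <- z | (n < i)%N].
    by apply: eq_filter => i /=; rewrite ltnNge.
  rewrite ehi; split=> [/andP[/eqP el /eqP eh]|[_ el eh]].
    split=> //.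
      apply/allP => i iz; have [le|lt] := leqP i n.
        have: i \in w by rewrite -el mem_filter le.
        by move/(allP lw) => /=; lia.
      have: i \in map (addn n) v by rewrite -eh mem_filter lt.
      by move=> /mapP[j /(allP lv) + ->] /=; lia.
    by rewrite /high eh -map_comp -[RHS]map_id; apply: eq_map => i /=; lia.
  rewrite -/(low n z) el -eh /high -map_comp map_id_in ?eqxx // => i.
  by rewrite mem_filter /= => /andP[lt _]; rewrite subnKC // ltnW.
have memL z : z \in L <-> letters (n + m) z /\ separated hJ hK n m x y z.
  split.
    move=> /flatten_mapP[w /mem_rwords[rw ew] /flatten_mapP[v /mem_rwords[rv ev]]].
    have [[lw _] [lv _]] := (rw, rv).
    by move=> /(mem_sh _ _ _ lw lv)[lz elo ehi]; split=> //; split; rewrite ?elo ?ehi.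
  case=> lz [rl el rh eh]; have [[lw _] [lv _]] := (rl, rh).
  apply/flatten_mapP; exists (low n z); first exact/mem_rwords.
  apply/flatten_mapP; exists (high n z); first exact/mem_rwords.
  exact/mem_sh.
exists (undup (map (wprod g) L)); split; last first.
  by move=> r; rewrite mem_undup => /mapP[z /memL[lz _] ->]; exists z.
have -> : mulW (rsum k hJ n x) (rsum k hK m y) = \sum_(z <- L) << (z, (n + m)%N) >>.
  rewrite mulWE !rsumE bext_suml big_flatten big_map; apply: eq_bigr => w _.
  rewrite bext_sumr big_flatten big_map; apply: eq_bigr => v _.
  by rewrite bextUU.
rewrite (sum_fibers (c := wprod g) (R := rwords g (n + m))).
- by apply: eq_bigr => r _; rewrite rsumE.
- apply: (uniq_flatten_map (h := low n)) (uniq_rwords hJ n x) _ _.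
    move=> w /mem_rwords[[lw _] _].
    apply: (uniq_flatten_map (h := high n)) (uniq_rwords hK m y) _ _.
      move=> v /mem_rwords[[lv _] _].
      by apply: (uniq_shuffle (p := fun i => i <= n)%N); rewrite ?split_low ?split_high.
    by move=> v z /mem_rwords[[lv _] _] /(mem_sh _ _ _ lw lv)[].
  move=> w z /mem_rwords[[lw _] _] /flatten_mapP[v /mem_rwords[[lv _] _]].
  by case/(mem_sh _ _ _ lw lv).
- exact: uniq_rwords.
(* [closed] gives both inclusions: [L] contains the whole class of each of its words, and every word
   of [L] is reduced. *)
move=> z0 /memL[lz0 sz0] z; have [r0 cl] := closed _ _ _ lz0 sz0.
apply/idP/andP => [/mem_rwords[rz ez]|[/memL[lz sz] /eqP ez]].
  by rewrite ez eqxx; split=> //; apply/memL; have [lz _] := rz; split=> //; apply: cl.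
by apply/mem_rwords; split=> //; have [] := closed _ _ _ lz sz.
Qed.

(** * From generators to the spans *)

Section Assemble.
Variables (k : fieldType) (M A : W k -> Prop).

Lemma span_graded_subcoalgebra :
  (forall x, M x -> forall m, span M (hpart m x)) ->
  (forall x, M x -> span (fun X => exists u v,
     [/\ span M u, span M v & X = tens u v]) (cop x)) ->
  graded_subcoalgebra (span M).
Proof.
move=> hM cM; split=> x sx.
  move=> m; elim/span_ind: x / sx => [|c x y Mx IH]; rewrite hpartE.
    by rewrite linear0; apply: span0.
  by rewrite extP -!hpartE; apply: spanP IH; apply: hM.
elim/span_ind: x / sx => [|c x y Mx IH]; rewrite copE.
  by rewrite linear0; apply: span0.
by rewrite extP -!copE; apply: spanP IH; apply: cM.
Qed.

Lemma span_mulW : (forall x a, M x -> A a -> span M (mulW x a)) ->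
  forall x a, span M x -> span A a -> span M (mulW x a).
Proof.
move=> mM x a sx sa; elim/span_ind: x / sx => [|c x y Mx IH]; rewrite mulWE.
  by rewrite bext0l; apply: span0.
rewrite bextPl -!mulWE; apply: spanP IH.
elim/span_ind: a / sa => [|d a b Aa IH]; rewrite mulWE.
  by rewrite bext0r; apply: span0.
by rewrite bextPr -!mulWE; apply: spanP IH; apply: mM.
Qed.

Lemma graded_right_module_coalgebra_of_closed (S T : W k -> Prop) :
  graded_subcoalgebra S -> (forall x a, S x -> T a -> S (mulW x a)) ->
  graded_right_module_coalgebra S T.
Proof.
move=> cS mS; split=> //; split; split=> //.
- by move=> x a b _ _ _; apply: mulWA.
- by move=> x _; apply: mulW1.
- by move=> x a _ _; apply: cop_mulW.
- by move=> x a _ _; apply: eps_mulW.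
by move=> x a p q _ _; apply: homog_mulW.
Qed.

End Assemble.

Lemma PiB_subcoalgebra (k : fieldType) : graded_subcoalgebra (PiB k).
Proof.
apply: span_graded_subcoalgebra => x [n [p [n0 pB ->]]].
  move=> m; have [->|->] := hpart_rsum k (sB n) n m p; last exact: span0.
  by apply: span_gen; exists n, p.
have [s [-> hs]] := cop_rsum k (sB n) n p.
apply: span_sum => -[q r] /hs[u [v [lu lv /= -> ->]]]; apply: span_gen.
exists (rsum k (sB n) n (wprod (sB n) u)), (rsum k (sB n) n (wprod (sB n) v)).
by split=> //; apply: span_gen; exists n; eexists; split=> //; apply: sB_Bgrp.
Qed.

Lemma PiD_subcoalgebra (k : fieldType) : graded_subcoalgebra (PiD k).
Proof.
apply: span_graded_subcoalgebra => x [n [p [n0 pD ->]]].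
  move=> m; have [->|->] := hpart_rsum k (sD n) n m p; last exact: span0.
  by apply: span_gen; exists n, p.
have [s [-> hs]] := cop_rsum k (sD n) n p.
apply: span_sum => -[q r] /hs[u [v [lu lv /= -> ->]]]; apply: span_gen.
exists (rsum k (sD n) n (wprod (sD n) u)), (rsum k (sD n) n (wprod (sD n) v)).
by split=> //; apply: span_gen; exists n; eexists; split=> //; apply: sD_Dgrp.
Qed.

Lemma PiB_mulW (k : fieldType) x a : PiB k x -> PiA k a -> PiB k (mulW x a).
Proof.
apply: span_mulW => {x a} _ _ [n [p [n0 _ ->]]] [m [q ->]].
have [s [-> hs]] := mulW_rsum k p q (@shuffle_closedB n m n0).
apply: span_sum => r /hs[u lu ->]; apply: span_gen.
by exists (n + m)%N, (wprod (sB (n + m)) u); split; [lia | apply: sB_Bgrp |].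
Qed.

Lemma PiD_mulW (k : fieldType) x a : PiD k x -> PiA k a -> PiD k (mulW x a).
Proof.
apply: span_mulW => {x a} _ _ [n [p [n1 _ ->]]] [m [q ->]].
have [s [-> hs]] := mulW_rsum k p q (@shuffle_closedD n m n1).
apply: span_sum => r /hs[u lu ->]; apply: span_gen.
by exists (n + m)%N, (wprod (sD (n + m)) u); split; [lia | apply: sD_Dgrp |].
Qed.

Theorem theorem6p6 (k : fieldType) (char0 : [pchar k]%R =i pred0) :
  (graded_subcoalgebra (PiB k) /\ graded_right_module_coalgebra (PiB k) (PiA k)) /\
  (graded_subcoalgebra (PiD k) /\ graded_right_module_coalgebra (PiD k) (PiA k)).
Proof.
have [cB cD] := (PiB_subcoalgebra k, PiD_subcoalgebra k).
do 2!split=> //; apply: graded_right_module_coalgebra_of_closed => //.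
  exact: PiB_mulW.
exact: PiD_mulW.
Qed.
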